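(* Let $l \geq 3$ and $k \geq 2$ be integers. If $n = 2k+2$, then $$\mathrm{ES}_{\ell}(l,n) > (l-1)\binom{2k-2}{k-1}^2 - (l-3)\binom{2k-4}{k-2}\binom{2k-2}{k-1}.$$ If $n = 2k+1$, then $$\mathrm{ES}_{\ell}(l,n) > (l-1)\left\{\binom{2k-2}{k-1}+1\right\}\binom{2k-3}{k-1} - (l-3)\binom{2k-4}{k-2}\binom{2k-2}{k-1}.$$
   Context: All lines are in the plane with fixed $x,y$ coordinates. A finite family of lines is in nearly general position if no two of its lines are parallel and no line is vertical. For a finite family $L$ of lines and $k \geq 2$, $L$ defines a $k$-cell $P$ if $P$ is a connected component of the complement of the union of the lines of $L$ and the boundary of $P$ contains a segment of positive length from exactly $k$ of the lines. A family of $n$ lines is in convex position if it defines an $n$-cell. Lines are concurrent if they all pass through a common point. For $n \geq 2$, $l \geq 3$, $\mathrm{ES}_{\ell}(l,n)$ denotes the minimum $N$ such that every family of $N$ lines in the plane in nearly general position contains either $l$ concurrent lines or a subfamily of $n$ lines in convex position. *)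

(* Defs.v *)
From HB Require Import structures.
From mathcomp Require Import all_boot all_order all_algebra.
From mathcomp Require Import all_classical all_reals all_analysis.

Set Implicit Arguments.
Unset Strict Implicit.
Unset Printing Implicit Defensive.

Import Order.TTheory GRing.Theory Num.Theory.
Import numFieldNormedType.Exports.

Local Open Scope classical_set_scope.
Local Open Scope ring_scope.

Section Lines.
Context {R : realType}.

Definition is_line (ell : set (R * R)) : Prop :=
  exists a b c : R,
    ((a != 0) || (b != 0)) /\ ell = [set p | a * p.1 + b * p.2 = c].

Definition vertical (ell : set (R * R)) : Prop :=
  exists c : R, ell = [set p | p.1 = c].

(* A line is parallel to itself: a family in nearly general position
   therefore has no repeated line, and the indexed families used below are
   the same thing as finite sets of lines. *)
Definition parallel (ell m : set (R * R)) : Prop :=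
  ell = m \/ ell `&` m = set0.

Definition segment (p q : R * R) : set (R * R) :=
  [set ((1 - t) * p.1 + t * q.1, (1 - t) * p.2 + t * q.2) | t in `[0, 1]].

Definition boundary (P : set (R * R)) : set (R * R) :=
  closure P `\` interior P.

Definition bounded_by (P ell : set (R * R)) : Prop :=
  exists p q : R * R,
    p != q /\ segment p q `<=` ell `&` boundary P.

Section Family.
Context {I : finType}.
Implicit Types L : I -> set (R * R).

Definition nearly_general_position L : Prop :=
  (forall i j, i != j -> ~ parallel (L i) (L j)) /\
  (forall i, ~ vertical (L i)).

Definition concurrent L : Prop := exists p : R * R, forall i, L i p.

Definition lines_complement L : set (R * R) := ~` \bigcup_i L i.

Definition is_component L (P : set (R * R)) : Prop :=
  exists2 x, lines_complement L x &
    P = connected_component (lines_complement L) x.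

Definition defines_cell L (k : nat) : Prop :=
  exists2 P, is_component L P & #|[set i | `[< bounded_by P (L i) >]]%SET| = k.

Definition convex_position L : Prop := defines_cell L #|I|.

End Family.
End Lines.

(* Subfamilies of size m are given by injections 'I_m -> 'I_N. *)
Definition ES_property (R : realType) (l n N : nat) : Prop :=
  forall L : 'I_N -> set (R * R),
    (forall i, is_line (L i)) ->
    nearly_general_position L ->
    (exists2 f : 'I_l -> 'I_N, injective f & concurrent (L \o f)) \/
    (exists2 f : 'I_n -> 'I_N, injective f & convex_position (L \o f)).

(* is_ES R l n N : N is the number ES_l(l, n). *)
Definition is_ES (R : realType) (l n N : nat) : Prop :=
  ES_property R l n N /\ forall M, ES_property R l n M -> (N <= M)%N.

(* Main.v *)
(* Dualize: the line y = a x - b becomes the point (a, b), concurrent lines become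
   collinear points, and a cell of a family of lines becomes a partition of the
   dual points into a set U above and a set W below some line.  The family is in
   convex position only if through every point p there is a line, of slope th p,
   having the other points of U above it and the other points of W below it.

   The extremal point set is X[Y]: each point of an Erdős–Szekeres tree X is
   replaced by a tiny copy of an Erdős–Szekeres tree Y whose slopes exceed those
   of X, and in some of these copies each point is replaced by l - 1 collinear
   points of slope -1, below all other slopes.  In X the slope between the two
   halves of a subtree exceeds the slopes inside the halves, in Y it is smaller.
   With this choice a convex (U, W) in X with both parts nonempty is either tiny or
   has W in the left and U in the right half of a subtree, and in Y it is the other
   way round.  In X[Y], tangents steeper than X occur in at most two of the copies
   of Y, and everything to the left of such a copy is in U, everything to its right
   in W. *)
Require Import Defs.
From HB Require Import structures.
From mathcomp Require Import all_boot all_order all_algebra.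
From mathcomp Require Import all_classical all_reals all_analysis.
From mathcomp Require Import zify ring lra.

Set Implicit Arguments.
Unset Strict Implicit.
Unset Printing Implicit Defensive.

Import Order.TTheory GRing.Theory Num.Theory.

Local Open Scope ring_scope.

(** * Pairs of elements of a sequence *)

Section Pairs.
Context {T : eqType}.
Implicit Types (s : seq T) (r : rel T) (a : pred T).

Lemma pwP r s :
  (forall p q, subseq [:: p; q] s -> r p q) <-> pairwise r s.
Proof.
split=> [h|h p q sub]; last by have := subseq_pairwise sub h; rewrite pairwise2.
elim: s h => //= x s IH h; apply/andP; split; last first.
  by apply: IH => p q sub; apply: h; apply: subseq_trans sub (subseq_cons _ _).
by apply/allP=> y ys; apply: h; rewrite eqxx sub1seq.
Qed.

Lemma subseq2_mem p q s : subseq [:: p; q] s -> p \in s /\ q \in s.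
Proof. by move/mem_subseq=> h; split; apply: h; rewrite !inE eqxx ?orbT. Qed.

Lemma subseq2_filter a p q s : subseq [:: p; q] (seq.filter a s) ->
  [/\ a p, a q & subseq [:: p; q] s].
Proof.
move=> sub; have [] := subseq2_mem sub.
rewrite !mem_filter => /andP[-> _] /andP[-> _]; split=> //.
exact: subseq_trans sub (filter_subseq _ _).
Qed.

Lemma size_le1 s : (forall p q, subseq [:: p; q] s -> False) -> (size s <= 1)%N.
Proof.
case: s => [|p [|q s]] // h; exfalso; apply: (h p q).
by rewrite /= !eqxx ?sub0seq.
Qed.

Lemma size_le2 s :
  (forall p q u, subseq [:: p; q] s -> subseq [:: q; u] s ->
     subseq [:: p; u] s -> False) -> (size s <= 2)%N.
Proof.
case: s => [|p [|q [|u s]]] // h; exfalso; apply: (h p q u).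
- by rewrite /= !eqxx ?sub0seq.
- by apply: (@subseq_trans _ [:: q, u & s]); rewrite ?subseq_cons //= !eqxx ?sub0seq.
- apply: (@subseq_trans _ [:: p, u & s]); first by rewrite /= !eqxx ?sub0seq.
  by rewrite (@cat_subseq _ [:: p] _ [:: p]) // subseq_cons.
Qed.

Lemma size_filterC a s :
  size s = (size (seq.filter a s) + size (seq.filter (predC a) s))%N.
Proof. by rewrite !size_filter count_predC. Qed.

Lemma pw_split r s t p : pairwise r (s ++ p :: t) ->
  (forall q, q \in s -> r q p) /\ (forall q, q \in t -> r p q).
Proof.
rewrite pairwise_cat pairwise_cons allrel_consr.
by case/and3P=> /andP[/allP h1 _] _ /andP[/allP h2 _].
Qed.

End Pairs.

(** * Convex position in terms of slopes *)

Section Convex.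
Context {R : realFieldType} {T : eqType}.
Implicit Types (sl : T -> T -> R) (th : T -> R) (sg : pred T) (Q : seq T).

(* [sg p] says that [p] is in U, [th p] is the slope of the tangent at [p], and
   [p] is to the left of [q]: the tangent at each of the two points is on the
   prescribed side of the other point. *)
Definition cv sl th sg : rel T := fun p q =>
  match sg p, sg q with
  | true, true => (th p < sl p q) && (sl p q < th q)
  | false, false => (th q < sl p q) && (sl p q < th p)
  | true, false => (sl p q < th p) && (sl p q < th q)
  | false, true => (th p < sl p q) && (th q < sl p q)
  end.

(** All that the combinatorial part knows of the plane: the slope of the long side of a triangle is
    a weighted mean of the other two slopes. *)
Definition med sl Q := forall p q r, subseq [:: p; q; r] Q ->
  (sl p q <= sl p r <= sl q r) || (sl q r <= sl p r <= sl p q).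

Lemma med_subseq sl Q Q' : subseq Q' Q -> med sl Q -> med sl Q'.
Proof. by move=> sub h p q r sub'; apply: h; apply: subseq_trans sub. Qed.

(* The reflection (x, y) -> (-x, y), together with the reversal of sequences. *)
Definition opp_sl sl : T -> T -> R := fun p q => - sl q p.
Definition opp_th th : T -> R := fun p => - th p.

Lemma cv_opp sl th sg p q :
  cv (opp_sl sl) (opp_th th) sg p q = cv sl th sg q p.
Proof.
rewrite /cv /opp_sl /opp_th; case: (sg p); case: (sg q); rewrite !ltrN2 //.
all: by rewrite andbC.
Qed.

Lemma pairwise_rev (r : rel T) Q :
  pairwise r (rev Q) = pairwise (fun p q => r q p) Q.
Proof.
by elim: Q => //= p Q IH; rewrite rev_cons pairwise_rcons IH all_rev.
Qed.

Lemma cv_rev sl th sg Q : pairwise (cv sl th sg) Q ->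
  pairwise (cv (opp_sl sl) (opp_th th) sg) (rev Q).
Proof.
by rewrite pairwise_rev; apply: sub_pairwise => p q; rewrite cv_opp.
Qed.

Lemma med_rev sl Q : med sl Q -> med (opp_sl sl) (rev Q).
Proof.
move=> h p q r; rewrite -[X in subseq X _]revK subseq_rev => /h.
by rewrite /opp_sl !lerN2 orbC => /orP[]/andP[-> ->]; rewrite ?orbT.
Qed.

(* The half-turn, which exchanges U and W. *)
Definition rot_sl sl : T -> T -> R := fun p q => sl q p.

Lemma cv_rot sl th sg p q : cv (rot_sl sl) th (predC sg) p q = cv sl th sg q p.
Proof. by rewrite /cv /rot_sl /=; case: (sg p); case: (sg q); rewrite //= andbC. Qed.

Lemma cv_rev_rot sl th sg Q : pairwise (cv sl th sg) Q ->
  pairwise (cv (rot_sl sl) th (predC sg)) (rev Q).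
Proof.
by rewrite pairwise_rev; apply: sub_pairwise => p q; rewrite cv_rot.
Qed.

Lemma med_rev_rot sl Q : med sl Q -> med (rot_sl sl) (rev Q).
Proof.
move=> h p q r; rewrite -[X in subseq X _]revK subseq_rev => /h.
by rewrite /rot_sl orbC.
Qed.

Lemma alternating_le2 sg Q : pairwise (fun p q => sg p != sg q) Q -> (size Q <= 2)%N.
Proof.
move=> /pwP h; apply: size_le2 => p q r /h + /h + /h.
by case: (sg p); case: (sg q); case: (sg r).
Qed.

(** Of three collinear points, the tangents at the ends force equal signs on all three, while the
    tangent at the middle point separates the outer two. *)
Lemma collinear_le2 sl th sg Q d : pairwise (cv sl th sg) Q ->
  pairwise (fun p q => sl p q == d) Q -> (size Q <= 2)%N.
Proof.
move=> /pwP h /pwP e; apply: size_le2 => p q r s1 s2 s3.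
move: (h _ _ s1) (h _ _ s2) (h _ _ s3) (e _ _ s1) (e _ _ s2) (e _ _ s3).
rewrite /cv; case: (sg p); case: (sg q); case: (sg r) => /andP[a1 a2] /andP[b1 b2] /andP[c1 c2];
  by move=> /eqP ? /eqP ? /eqP ?; lra.
Qed.

End Convex.

(** * Trees with increasing slopes *)

Section Up.
Context {R : realFieldType} {T : eqType}.
Implicit Types (sl : T -> T -> R) (th : T -> R) (sg : pred T) (Q : seq T).
Implicit Types (base : nat -> nat -> seq T -> Prop).

(* [a] bounds the size of the cups and [b] that of the caps.  The slopes below [H]
   increase towards the root and are smaller than [h]; those of at least [H] are
   inside the leaves.  The last premise of [up_node] controls the convex sets
   formed by a cap of the left and a cup of the right subtree. *)
Inductive up sl (H : R) (B : nat) base : R -> nat -> nat -> seq T -> Prop :=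
| up_base h a b Q of base a b Q
    & pairwise (fun p q => (sl p q < h) || (H <= sl p q)) Q : up sl H B base h a b Q
| up_node h s a b a1 b1 a2 b2 Q1 Q2 of up sl H B base s a1 b1 Q1
    & up sl H B base s a2 b2 Q2 & s < h & h <= H
    & allrel (fun p q => (s < sl p q) && (sl p q < h)) Q1 Q2
    & (a1 < a)%N & (a2 <= a)%N & (b1 <= b)%N & (b2 < b)%N & (b1 + a2 <= B)%N :
    up sl H B base h a b (Q1 ++ Q2).

Lemma subseq_catP Q (Q1 Q2 : seq T) : subseq Q (Q1 ++ Q2) ->
  exists P1 P2, [/\ Q = P1 ++ P2, subseq P1 Q1 & subseq P2 Q2].
Proof.
elim: Q1 Q => [|x Q1 IH] Q; first by exists [::], Q.
case: Q => [|y Q]; first by exists [::], [::]; split=> //; apply: sub0seq.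
rewrite /=; case: eqP => [->|_] /IH[P1 [P2 [-> s1 s2]]].
  by exists (x :: P1), P2; rewrite /= eqxx.
case: P1 s1 => [|z P1] s1; first by exists [::], P2.
exists (z :: P1), P2; split=> //.
exact: subseq_trans s1 (subseq_cons _ _).
Qed.

Lemma allrel_subseq (r : rel T) P1 P2 (Q1 Q2 : seq T) :
  subseq P1 Q1 -> subseq P2 Q2 -> allrel r Q1 Q2 -> allrel r P1 P2.
Proof.
move=> /mem_subseq s1 /mem_subseq s2 /allrelP h.
by apply/allrelP => p q /s1 p1 /s2; apply: h.
Qed.

Lemma up_subseq sl H B base h a b Q Q' :
  (forall a b Q Q', base a b Q -> subseq Q' Q -> base a b Q') ->
  up sl H B base h a b Q -> subseq Q' Q -> up sl H B base h a b Q'.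
Proof.
move=> bsub u; elim: u Q' => {h a b Q}.
  move=> h a b Q bQ pw Q' sub; apply: up_base; first exact: bsub bQ sub.
  exact: subseq_pairwise sub pw.
move=> h s a b a1 b1 a2 b2 Q1 Q2 _ IH1 _ IH2 sh hH x ? ? ? ? ? Q'.
case/subseq_catP=> P1 [P2 [-> s1 s2]].
by apply: (up_node (IH1 _ s1) (IH2 _ s2)) => //; apply: allrel_subseq x.
Qed.

Lemma up_pair sl H B base h a b Q : up sl H B base h a b Q ->
  pairwise (fun p q => (sl p q < h) || (H <= sl p q)) Q.
Proof.
elim=> {h a b Q} // h s a b a1 b1 a2 b2 Q1 Q2 _ IH1 _ IH2 sh hH x _ _ _ _ _.
have lift : subrel (fun p q => (sl p q < s) || (H <= sl p q))
                   (fun p q => (sl p q < h) || (H <= sl p q)).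
  by move=> p q /orP[/lt_trans-> //|->]; rewrite orbT.
rewrite pairwise_cat; apply/and3P.
split; [|exact: (sub_pairwise lift)|exact: (sub_pairwise lift)].
by apply: sub_allrel x => p q /andP[_ ->].
Qed.

(** The half-turn turns caps into cups, which exchanges the two bounds; the premise [b1 + a2 <= B]
    is symmetric under this exchange. *)
Lemma up_rot sl H B base h a b Q : up sl H B base h a b Q ->
  up (rot_sl sl) H B (fun a b Q => base b a (rev Q)) h b a (rev Q).
Proof.
elim=> {h a b Q} [h a b Q bQ pw|h s a b a1 b1 a2 b2 Q1 Q2 _ IH1 _ IH2 ? ? x ? ? ? ? ?].
  by apply: up_base; rewrite ?revK // pairwise_rev.
rewrite rev_cat; apply: (up_node IH2 IH1) => //; last by rewrite addnC.
by rewrite allrel_rev2 allrelC; apply: sub_allrel x.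
Qed.

Section Node.
Variables (sl : T -> T -> R) (th : T -> R) (sg : pred T) (H s h : R).
Variables (Q1 Q2 : seq T).
Hypothesis cvQ : pairwise (cv sl th sg) (Q1 ++ Q2).
Hypothesis crossQ : allrel (fun p q => (s < sl p q) && (sl p q < h)) Q1 Q2.

Lemma node_cv p q : p \in Q1 -> q \in Q2 -> cv sl th sg p q.
Proof. by move: cvQ; rewrite pairwise_cat => /and3P[/allrelP c _ _]; apply: c. Qed.

Lemma node_cross p q : p \in Q1 -> q \in Q2 -> s < sl p q < h.
Proof. by move/allrelP: crossQ; apply. Qed.

(** A point of W in the right half lies below the tangent at [p], which is thus steeper than the
    joining slope. Likewise, a point of U in the left half makes all tangents in the right half
    steep. *)
Lemma node_thl p q : p \in Q1 -> q \in Q2 -> ~~ sg q -> s < th p.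
Proof.
move=> p1 q2; have := node_cv p1 q2; have /andP[? ?] := node_cross p1 q2.
by rewrite /cv; case: (sg p); case: (sg q) => // /andP[? ?] _; lra.
Qed.

Lemma node_thr p q : p \in Q1 -> q \in Q2 -> sg p -> s < th q.
Proof.
move=> p1 q2; have := node_cv p1 q2; have /andP[? ?] := node_cross p1 q2.
by rewrite /cv; case: (sg p); case: (sg q) => // /andP[? ?] _; lra.
Qed.
End Node.

(* All tangents being steeper than [s], the flat pairs are of type (U, W). *)
Lemma steep_tangents sl th sg (s H : R) Q :
  pairwise (cv sl th sg) Q ->
  pairwise (fun p q => (sl p q < s) || (H <= sl p q)) Q ->
  {in Q, forall p, s < th p} ->
  forall p q, subseq [:: p; q] Q -> sl p q < H -> sg p && ~~ sg q.
Proof.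
move=> /pwP c /pwP f t p q sub ns.
have [/t tp /t tq] := subseq2_mem sub.
have := c _ _ sub; have := f _ _ sub; rewrite leNgt ns orbF /cv.
by case: (sg p); case: (sg q) => // ? /andP[? ?]; lra.
Qed.

(** * Sizes of convex sets in a tree with increasing slopes *)

Section Bounds.
Variables (sl : T -> T -> R) (th : T -> R) (sg : pred T) (H : R) (B : nat).
Variable base : nat -> nat -> seq T -> Prop.
Notation cvx := (pairwise (cv sl th sg)).
Notation flat := (pairwise (fun p q => sl p q < H)).
Notation upc := (up sl H B base).

Lemma nonempty_mem (Q : seq T) : Q != [::] -> exists p, p \in Q.
Proof. by case: Q => // p Q _; exists p; rewrite mem_head. Qed.

(** A line meeting both halves has a slope between [s] and [H], which does not occur inside the
    halves, so it has at most one point in each. *)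
Lemma const_slope_bound c d h a b Q :
  (forall a b Q, base a b Q -> pairwise (fun p q => sl p q == c) Q -> (size Q <= d)%N) ->
  (1 < d)%N -> upc h a b Q -> pairwise (fun p q => sl p q == c) Q -> (size Q <= d)%N.
Proof.
move=> bs d1; elim=> {h a b Q} [h a b Q bQ _|]; first exact: bs bQ.
move=> h s a b a1 b1 a2 b2 Q1 Q2 u1 IH1 u2 IH2 sh hH x _ _ _ _ _.
have [-> //|/nonempty_mem[p1 p1Q]] := eqVneq Q1 [::].
have [->|/nonempty_mem[p2 p2Q]] := eqVneq Q2 [::]; first by rewrite cats0.
rewrite pairwise_cat => /and3P[/allrelP/(_ _ _ p1Q p2Q)/eqP e /pwP e1 /pwP e2].
have := allrelP x _ _ p1Q p2Q; rewrite e => /andP[x1 x2].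
have [/pwP f1 /pwP f2] := (up_pair u1, up_pair u2).
have s1 : (size Q1 <= 1)%N.
  apply: size_le1 => p q sub; move: (f1 _ _ sub); rewrite (eqP (e1 _ _ sub)).
  by case/orP => ?; lra.
have s2 : (size Q2 <= 1)%N.
  apply: size_le1 => p q sub; move: (f2 _ _ sub); rewrite (eqP (e2 _ _ sub)).
  by case/orP => ?; lra.
by rewrite size_cat; apply: leq_trans (leq_add s1 s2) d1.
Qed.

(** Flat slopes inside the right half are smaller than those across, so a flat cup that meets the
    left half has at most one point on the right. *)
Lemma cups_bound h a b Q :
  (forall a b Q, base a b Q -> cvx Q -> flat Q -> all sg Q -> (size Q <= a)%N) ->
  upc h a b Q -> cvx Q -> flat Q -> all sg Q -> (size Q <= a)%N.
Proof.
move=> bs; elim=> {h a b Q} [h a b Q bQ _|]; first exact: bs bQ.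
move=> h s a b a1 b1 a2 b2 Q1 Q2 u1 IH1 u2 IH2 sh hH x aa ? _ _ _ c.
have := c; rewrite !pairwise_cat all_cat => /and3P[_ c1 c2] /and3P[_ f1 f2] /andP[g1 g2].
have [->|/nonempty_mem[p pQ]] := eqVneq Q1 [::].
  by apply: leq_trans (IH2 c2 f2 g2) _.
have s2 : (size Q2 <= 1)%N.
  apply: size_le1 => q r sub; have [_ rQ] := subseq2_mem sub.
  have t2 := fun q q2 => node_thr c x pQ q2 (allP g1 _ pQ) (q := q).
  have := steep_tangents c2 (up_pair u2) t2 sub ((pwP _ _).2 f2 _ _ sub).
  by rewrite (allP g2 _ rQ) andbF.
rewrite size_cat; by apply: leq_trans (leq_add (IH1 c1 f1 g1) s2) _; rewrite addn1.
Qed.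

End Bounds.

Section Bounds2.
Variables (sl : T -> T -> R) (th : T -> R) (sg : pred T) (H : R) (B : nat).
Variable base : nat -> nat -> seq T -> Prop.
Notation cvx := (pairwise (cv sl th sg)).
Notation flat := (pairwise (fun p q => sl p q < H)).
Notation upc := (up sl H B base).

Lemma caps_bound h a b Q :
  (forall a b Q, base a b Q -> cvx Q -> flat Q -> all (predC sg) Q -> (size Q <= b)%N) ->
  upc h a b Q -> cvx Q -> flat Q -> all (predC sg) Q -> (size Q <= b)%N.
Proof.
move=> bs /up_rot u /cv_rev_rot c f g; rewrite -size_rev.
apply: (cups_bound _ u c); rewrite ?all_rev ?pairwise_rev //.
move=> a' b' P bP cP fP gP; rewrite -size_rev; apply: bs bP _ _ _.
- by have := cv_rev_rot cP; congr is_true; apply: eq_pairwise => p q;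
    rewrite /cv /rot_sl /= !negbK.
- by rewrite pairwise_rev.
- by rewrite all_rev.
Qed.

(** No pair across is of type (W, U), so if both halves are used, U occurs on the left and W on the
    right. All tangents are then steeper than [s], flat pairs inside the halves are of type (U, W),
    and signs alternate in each half. *)
Lemma mixed_bound (r : rel T) n h a b Q :
  (forall p q, r p q -> (sg p == sg q -> sl p q < H) /\ (~~ sg p -> sg q -> H <= sl p q)) ->
  (forall a b Q, base a b Q -> cvx Q -> pairwise r Q -> (size Q <= n)%N) ->
  (2 < n)%N -> upc h a b Q -> cvx Q -> pairwise r Q ->
  has sg Q -> has (predC sg) Q -> (size Q <= n)%N.
Proof.
move=> rP bs n3; elim=> {h a b Q} [h a b Q bQ _ ? ? _ _|]; first exact: bs bQ _ _.
move=> h s a b a1 b1 a2 b2 Q1 Q2 u1 IH1 u2 IH2 sh hH x _ _ _ _ _ c.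
have := c; rewrite !pairwise_cat => /and3P[_ c1 c2] /and3P[/allrelP rx r1 r2].
have [-> //|/nonempty_mem[p1 p1Q]] := eqVneq Q1 [::]; first exact: IH2.
have [->|/nonempty_mem[p2 p2Q]] := eqVneq Q2 [::].
  by rewrite cats0; apply: IH1.
have nWU p q : p \in Q1 -> q \in Q2 -> ~~ sg p -> ~~ sg q.
  move=> pQ qQ np; apply/negP => gq; have := (rP _ _ (rx _ _ pQ qQ)).2 np gq.
  by have /andP[] := node_cross x pQ qQ; lra.
rewrite !has_cat => hU hW.
have [u uQ gu] : exists2 u, u \in Q1 & sg u.
  apply/hasP; case/orP: hU => // /hasP[q qQ gq]; apply/hasP; exists p1 => //.
  by apply: contraTT gq => /(nWU _ _ p1Q qQ).
have [w wQ gw] : exists2 w, w \in Q2 & ~~ sg w.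
  case/orP: hW => /hasP[q qQ gq]; last by exists q.
  by exists p2 => //; apply: nWU gq.
have alt Q' a' b' : upc s a' b' Q' -> cvx Q' -> pairwise r Q' -> {in Q', forall p, s < th p} ->
    pairwise (fun p q => sg p != sg q) Q'.
  move=> u' c' /pwP r' t'; apply/pwP => p q sub; apply/eqP => e.
  have := steep_tangents c' (up_pair u') t' sub.
  by case: (rP _ _ (r' _ _ sub)) => /(_ (introT eqP e)) f _ /(_ f); rewrite e andbN.
have A1 := alt _ _ _ u1 c1 r1 (fun p pQ => node_thl c x pQ wQ gw).
have A2 := alt _ _ _ u2 c2 r2 (fun p pQ => node_thr c x uQ pQ gu).
have [le1 le2] := (alternating_le2 A1, alternating_le2 A2).
rewrite size_cat; case: (leqP (size Q1) 1) => [l1|s1].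
  exact: leq_trans (leq_add l1 le2) n3.
(* Two points of alternating signs on the left include one of W; it forces the right half into W,
   where alternation leaves one point. *)
have [w1 w1Q gw1] : exists2 w1, w1 \in Q1 & ~~ sg w1.
  move: (Q1) s1 A1 => [|p [|q Q']] //= _ /andP[/andP[g _] _].
  case: (boolP (sg p)) g => gp; case: (boolP (sg q)) => gq // _.
    by exists q => //; rewrite !inE eqxx orbT.
  by exists p => //; rewrite inE eqxx.
suff l2 : (size Q2 <= 1)%N by apply: leq_trans (leq_add le1 l2) n3.
apply: size_le1 => p q sub; have [pQ qQ] := subseq2_mem sub.
have := (pwP _ _).2 A2 _ _ sub.
by rewrite (negPf (nWU _ _ w1Q pQ gw1)) (negPf (nWU _ _ w1Q qQ gw1)).
Qed.

Lemma same_sign_flat Q : cvx Q -> {in Q, forall p, th p < H} ->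
  pairwise (fun p q => (sg p == sg q) ==> (sl p q < H)) Q.
Proof.
move=> /pwP c t; apply/pwP => p q sub; apply/implyP => /eqP e.
have [/t tp /t tq] := subseq2_mem sub.
by have := c _ _ sub; rewrite /cv e; case: (sg q) => /andP[? ?]; lra.
Qed.

(** If the left half also meets W, the right half has one point, as for cups, and the left half at
    most four by [mixed_bound]; hence the constant 5. *)
Lemma node_cup_bound h s a b a1 b1 a2 b2 Q1 Q2 p0 :
  (forall a b Q, base a b Q -> cvx Q -> flat Q -> all sg Q -> (size Q <= a)%N) ->
  (forall a b Q, base a b Q -> cvx Q ->
     pairwise (fun p q => (sg p == sg q) ==> (sl p q < H)) Q -> (size Q <= 4)%N) ->
  upc h a b (Q1 ++ Q2) -> upc s a1 b1 Q1 -> upc s a2 b2 Q2 -> s < h -> h <= H ->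
  allrel (fun p q => (s < sl p q) && (sl p q < h)) Q1 Q2 ->
  cvx (Q1 ++ Q2) -> med sl (Q1 ++ Q2) -> {in Q1 ++ Q2, forall p, th p < H} ->
  p0 \in Q1 -> sg p0 -> Q2 != [::] -> all sg Q2 -> (size (Q1 ++ Q2) <= maxn a 5)%N.
Proof.
move=> bU bS u u1 u2 sh hH x c m t p0Q g0 /nonempty_mem[r rQ] g2.
have sf := same_sign_flat c t.
have [g1|ng1] := boolP (all sg Q1).
  have g : all sg (Q1 ++ Q2) by rewrite all_cat g1.
  rewrite leq_max (cups_bound bU u c _ g) //.
  apply/pwP => p q sub; have := (pwP _ _).2 sf _ _ sub.
  by have [pQ qQ] := subseq2_mem sub; rewrite !(allP g _ _).
have := c; have := sf; rewrite !pairwise_cat => /and3P[_ sf1 /pwP sf2] /and3P[_ c1 c2].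
have s2 : (size Q2 <= 1)%N.
  apply: size_le1 => p q sub; have [pQ qQ] := subseq2_mem sub.
  have fl : sl p q < H by have := sf2 _ _ sub; rewrite !(allP g2 _ _).
  have := steep_tangents c2 (up_pair u2) (fun q qQ => node_thr c x p0Q qQ g0) sub fl.
  by rewrite (allP g2 _ qQ) andbF.
have s1 : (size Q1 <= 4)%N.
  pose rel p q := ((sg p == sg q) ==> (sl p q < H)) && (~~ sg p && sg q ==> (H <= sl p q)).
  apply: (mixed_bound (r := rel) _ _ _ u1 c1) => //.
  - by move=> p q /andP[/implyP r1 /implyP r2]; split=> // a' b'; apply: r2; apply/andP.
  - move=> a' b' P bP cP rP; apply: bS bP cP _.
    by apply: sub_pairwise rP => p q /andP[].
  - apply/pwP => p q sub; rewrite /rel ((pwP _ _).2 sf1 _ _ sub) /=.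
    (* Suppose the pair is flat. The signs give [sl q r < th r < sl p r], but [med] and
       [sl p q < s < sl p r] give [sl p r <= sl q r]. *)
    apply/implyP => /andP[np gq]; rewrite leNgt; apply/negP => fl.
    have [pQ qQ] := subseq2_mem sub.
    have sub3 : subseq [:: p; q; r] (Q1 ++ Q2).
      by rewrite (@cat_subseq _ [:: p; q] [:: r]) // sub1seq.
    have := (pwP _ _).2 (up_pair u1) _ _ sub; rewrite leNgt fl orbF => ls.
    have /andP[x1 x2] := node_cross x pQ rQ.
    have := node_cv c pQ rQ; have := node_cv c qQ rQ.
    rewrite /cv (negPf np) gq (allP g2 _ rQ) => /andP[? ?] /andP[? ?].
    by case/orP: (m _ _ _ sub3) => /andP[? ?]; lra.
  - by apply/hasP; exists p0.
  - by rewrite has_predC.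
by rewrite size_cat leq_max (leq_add s1 s2) orbT.
Qed.

End Bounds2.

Section Bounds3.
Variables (sl : T -> T -> R) (th : T -> R) (sg : pred T) (H : R) (B : nat).
Variable base : nat -> nat -> seq T -> Prop.
Notation cvx := (pairwise (cv sl th sg)).
Notation flat := (pairwise (fun p q => sl p q < H)).
Notation upc := (up sl H B base).

Lemma cv_rot_inv Q : pairwise (cv (rot_sl sl) th (predC sg)) Q -> cvx (rev Q).
Proof.
by rewrite pairwise_rev; apply: sub_pairwise => p q; rewrite cv_rot.
Qed.

(** U on the left and W on the right make all tangents steeper than [s], so each half alternates and
    has at most two points. A left half in W followed by a right half in U is a cap and a cup,
    counted by [b1 + a2 <= B]. The other two cases are [node_cup_bound] and its image under the
    half-turn. *)
Lemma flat_tangent_bound h a b Q :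
  (forall a b Q, base a b Q -> cvx Q -> flat Q -> all sg Q -> (size Q <= a)%N) ->
  (forall a b Q, base a b Q -> cvx Q -> flat Q -> all (predC sg) Q -> (size Q <= b)%N) ->
  (forall a b Q, base a b Q -> cvx Q ->
     pairwise (fun p q => (sg p == sg q) ==> (sl p q < H)) Q -> (size Q <= 4)%N) ->
  (5 <= B)%N -> (a <= B)%N -> (b <= B)%N ->
  upc h a b Q -> cvx Q -> med sl Q -> {in Q, forall p, th p < H} -> (size Q <= B)%N.
Proof.
move=> bU bW bS B5 + + u.
elim: u => {h a b Q} [h a b Q bQ _ _ _ c m t|].
  exact: leq_trans (bS _ _ _ bQ c (same_sign_flat c t)) (ltnW B5).
move=> h s a b a1 b1 a2 b2 Q1 Q2 u1 IH1 u2 IH2 sh hH x aa1 aa2 bb1 bb2 bB aB bB' c m t.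
have u : upc h a b (Q1 ++ Q2) by exact: (up_node u1 u2).
have := c; rewrite pairwise_cat => /and3P[_ c1 c2].
have [m1 m2] := (med_subseq (prefix_subseq Q1 Q2) m, med_subseq (suffix_subseq Q1 Q2) m).
have t1 : {in Q1, forall p, th p < H} by move=> p pQ; apply: t; rewrite mem_cat pQ.
have t2 : {in Q2, forall p, th p < H} by move=> p pQ; apply: t; rewrite mem_cat pQ orbT.
have sf1 := same_sign_flat c1 t1; have sf2 := same_sign_flat c2 t2.
have [e1|n1] := eqVneq Q1 [::].
  by rewrite e1; apply: IH2 => //; [apply: leq_trans aB|apply: leq_trans (ltnW bb2) bB'].
have [e2|n2] := eqVneq Q2 [::].
  by rewrite e2 cats0; apply: IH1 => //; [apply: leq_trans (ltnW aa1) aB|apply: leq_trans bB'].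
have [/hasP[p0 p0Q g0]|nU1] := boolP (has sg Q1); have [g2|] := boolP (all sg Q2).
- apply: leq_trans (node_cup_bound bU bS u u1 u2 sh hH x c m t p0Q g0 n2 g2) _.
  by rewrite geq_max aB.
- rewrite -has_predC => /hasP[w wQ gw].
  have alt Q' a' b' : upc s a' b' Q' -> cvx Q' -> {in Q', forall p, th p < H} ->
      {in Q', forall p, s < th p} -> (size Q' <= 2)%N.
    move=> u' c' tH ts; apply: (@alternating_le2 _ sg); apply/pwP => p q sub; apply/eqP => e.
    have := (pwP _ _).2 (same_sign_flat c' tH) _ _ sub; rewrite e eqxx /= => fl.
    by have := steep_tangents c' (up_pair u') ts sub fl; rewrite e andbN.
  have l1 := alt _ _ _ u1 c1 t1 (fun p pQ => node_thl c x pQ wQ gw).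
  have l2 := alt _ _ _ u2 c2 t2 (fun p pQ => node_thr c x p0Q pQ g0).
  by rewrite size_cat; apply: leq_trans (leq_add l1 l2) (ltnW B5).
- have g1 : all (predC sg) Q1 by rewrite all_predC.
  have f1 : flat Q1.
    apply/pwP => p q sub; have [/(allP g1)/negPf gp /(allP g1)/negPf gq] := subseq2_mem sub.
    by have := (pwP _ _).2 sf1 _ _ sub; rewrite gp gq.
  have f2 : flat Q2.
    apply/pwP => p q sub; have [/(allP g2) gp /(allP g2) gq] := subseq2_mem sub.
    by have := (pwP _ _).2 sf2 _ _ sub; rewrite gp gq.
  rewrite size_cat; apply: leq_trans bB.
  by apply: leq_add; [apply: caps_bound bW u1 c1 f1 g1|apply: cups_bound bU u2 c2 f2 g2].
- rewrite -has_predC => /hasP[w wQ gw].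
  have := @node_cup_bound (rot_sl sl) th (predC sg) H B (fun a b Q => base b a (rev Q)) h s b a
    b2 a2 b1 a1 (rev Q2) (rev Q1) w.
  rewrite -rev_cat size_rev => /(_ _ _ (up_rot u) (up_rot u2) (up_rot u1)) nb.
  apply: leq_trans (nb _ _ sh hH _ _ _ _ _ gw _ _) _.
  + move=> a' b' P bP cP fP gP; rewrite -size_rev; apply: bW bP (cv_rot_inv cP) _ _.
      by rewrite pairwise_rev.
    by rewrite all_rev.
  + move=> a' b' P bP cP fP; rewrite -size_rev; apply: bS bP (cv_rot_inv cP) _.
    rewrite pairwise_rev; apply: sub_pairwise fP => p q /=.
    by rewrite eq_sym /rot_sl; case: (sg p); case: (sg q).
  + by rewrite allrel_rev2 allrelC; apply: sub_allrel x.
  + exact: cv_rev_rot.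
  + exact: med_rev_rot.
  + by move=> p; rewrite mem_rev; apply: t.
  + by rewrite mem_rev.
  + by rewrite -size_eq0 size_rev size_eq0.
  + by rewrite all_rev all_predC.
  + by rewrite geq_max bB'.
Qed.

End Bounds3.
End Up.

(** * The two-level configuration *)

Section TwoLevels.
Context {R : realFieldType} {T : eqType}.
Implicit Types (sl : T -> T -> R) (th : T -> R) (sg : pred T) (Q : seq T).

Definition leaf sl c (a b : nat) Q : Prop :=
  [/\ (0 < a)%N, (0 < b)%N, (size Q <= c)%N & pairwise (fun p q => sl p q == 1) Q].

(* Reflected, the tree Y is a tree with increasing slopes whose collinear leaves,
   of slope 1 after reflection, are its steep part. *)
Definition inner sl c B a b Q : Prop :=
  up (opp_sl sl) 1 B (leaf (opp_sl sl) c) 0 a b (rev Q).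

(* At most two points of a collinear leaf are used by a convex set, whence
   [minn c 2]. *)
Definition block sl m al be (a b : nat) Q : Prop :=
  exists c, [/\ (minn c 2 <= a)%N, (minn c 2 <= b)%N, (c <= m)%N &
    inner sl c (al + be).+1 al be Q].

Lemma leaf_subseq sl c a b Q Q' : leaf sl c a b Q -> subseq Q' Q -> leaf sl c a b Q'.
Proof.
move=> [? ? s e] sub; split=> //; first exact: leq_trans (size_subseq sub) s.
exact: subseq_pairwise sub e.
Qed.

Lemma inner_subseq sl c B a b Q Q' : inner sl c B a b Q -> subseq Q' Q -> inner sl c B a b Q'.
Proof. by move=> i sub; apply: up_subseq i _; [exact: leaf_subseq|rewrite subseq_rev]. Qed.

Lemma block_subseq sl m al be a b Q Q' :
  block sl m al be a b Q -> subseq Q' Q -> block sl m al be a b Q'.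
Proof. by move=> [c [? ? ? i]] sub; exists c; split=> //; apply: inner_subseq i sub. Qed.

(** With [h <= 0] the slopes across every node are negative, so a set with positive slopes stays in
    one leaf. After reflection this concerns the negative slopes of Y. *)
Lemma flat_leaf sl c B h a b Q : h <= 0 -> up sl 1 B (leaf sl c) h a b Q ->
  pairwise (fun p q => 0 < sl p q) Q -> leaf sl c 1 1 Q.
Proof.
move=> + u; elim: u => {h a b Q} [h a b Q [_ _ s e] _ _ _|]; first by split.
move=> h s a b a1 b1 a2 b2 Q1 Q2 _ IH1 _ IH2 sh _ x _ _ _ _ _ h0.
have s0 : s <= 0 by lra.
have [-> |/nonempty_mem[p pQ]] := eqVneq Q1 [::]; first exact: IH2.
have [->|/nonempty_mem[q qQ]] := eqVneq Q2 [::]; first by rewrite cats0; apply: IH1.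
rewrite pairwise_cat => /and3P[/allrelP/(_ _ _ pQ qQ) + _ _].
by have /andP[_] := allrelP x _ _ pQ qQ; lra.
Qed.

(** * Convex sets inside one copy of Y *)

Section Inner.
Variables (sl : T -> T -> R) (th : T -> R) (sg : pred T) (c B al be : nat).
Notation cvx := (pairwise (cv sl th sg)).

Lemma inner_flat Q : inner sl c B al be Q -> cvx Q ->
  pairwise (fun p q => sl p q < 0) Q -> (size Q <= minn c 2)%N.
Proof.
move=> /(flat_leaf (lexx _)) lf cQ fl; have [|_ _ s e] := lf.
  by rewrite pairwise_rev; apply: sub_pairwise fl => p q; rewrite /opp_sl oppr_gt0.
by rewrite -size_rev leq_min s (collinear_le2 (cv_rev cQ) e).
Qed.

(** Without slope -1 each collinear leaf contributes at most one point, within its positive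
    bounds. *)
Lemma inner_cups Q : inner sl c B al be Q -> cvx Q ->
  pairwise (fun p q => -1 < sl p q) Q -> all sg Q -> (size Q <= al)%N.
Proof.
move=> i /cv_rev cQ st g; rewrite -size_rev; apply: cups_bound i cQ _ _.
- move=> a b P [a0 _ _ /pwP e] _ /pwP f _; apply: leq_trans a0.
  by apply: size_le1 => p q sub; move: (f _ _ sub); rewrite (eqP (e _ _ sub)) ltxx.
- by rewrite pairwise_rev; apply: sub_pairwise st => p q; rewrite /opp_sl ltrNl.
- by rewrite all_rev.
Qed.

Lemma inner_caps Q : inner sl c B al be Q -> cvx Q ->
  pairwise (fun p q => -1 < sl p q) Q -> all (predC sg) Q -> (size Q <= be)%N.
Proof.
move=> i /cv_rev cQ st g; rewrite -size_rev; apply: caps_bound i cQ _ _.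
- move=> a b P [_ b0 _ /pwP e] _ /pwP f _; apply: leq_trans b0.
  by apply: size_le1 => p q sub; move: (f _ _ sub); rewrite (eqP (e _ _ sub)) ltxx.
- by rewrite pairwise_rev; apply: sub_pairwise st => p q; rewrite /opp_sl ltrNl.
- by rewrite all_rev.
Qed.

Lemma inner_mixed Q : inner sl c B al be Q -> cvx Q ->
  pairwise (fun p q => ((sg p == sg q) ==> (-1 < sl p q)) &&
                       (sg p && ~~ sg q ==> (sl p q <= -1))) Q ->
  has sg Q -> has (predC sg) Q -> (size Q <= 3)%N.
Proof.
move=> i /cv_rev cQ st hU hW; rewrite -size_rev.
pose r p q := ((sg p == sg q) ==> (opp_sl sl p q < 1)) &&
              (~~ sg p && sg q ==> (1 <= opp_sl sl p q)).
apply: (mixed_bound (r := r) _ _ _ i cQ) => //; rewrite ?has_rev //.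
- by move=> p q /andP[/implyP r1 /implyP r2]; split=> // a' b'; apply: r2; apply/andP.
- move=> a b P [_ _ _ e] cP _; exact: leq_trans (collinear_le2 cP e) _.
- rewrite pairwise_rev; apply: sub_pairwise st => p q /andP[/implyP r1 /implyP r2].
  apply/andP; split; apply/implyP; rewrite /opp_sl.
    by rewrite eq_sym => /r1; lra.
  by rewrite andbC => /r2; lra.
Qed.

Lemma inner_bound_high Q : inner sl c B al be Q -> cvx Q -> med sl Q ->
  (5 <= B)%N -> (al <= B)%N -> (be <= B)%N ->
  {in Q, forall p, -1 < th p} -> (size Q <= B)%N.
Proof.
move=> i /cv_rev cQ /med_rev mQ B5 aB bB t; rewrite -size_rev.
apply: (flat_tangent_bound _ _ _ B5 aB bB i cQ mQ).
- move=> a b P [a0 _ _ /pwP e] _ /pwP f _; apply: leq_trans a0.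
  by apply: size_le1 => p q sub; move: (f _ _ sub); rewrite (eqP (e _ _ sub)) ltxx.
- move=> a b P [_ b0 _ /pwP e] _ /pwP f _; apply: leq_trans b0.
  by apply: size_le1 => p q sub; move: (f _ _ sub); rewrite (eqP (e _ _ sub)) ltxx.
- by move=> a b P [_ _ _ e] cP _; apply: leq_trans (collinear_le2 cP e) _.
- by move=> p; rewrite mem_rev /opp_th => /t ?; lra.
Qed.

Lemma low_left p q : cv sl th sg p q -> -1 <= sl p q -> th q <= -1 -> ~~ sg p.
Proof. by rewrite /cv; case: (sg p); case: (sg q) => // /andP[? ?]; lra. Qed.

Lemma low_right p q : cv sl th sg p q -> -1 <= sl p q -> th p <= -1 -> sg q.
Proof. by rewrite /cv; case: (sg p); case: (sg q) => // /andP[? ?]; lra. Qed.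

Lemma high_pair p q : cv sl th sg p q -> -1 < th p -> -1 < th q -> sl p q <= -1 ->
  sg p && ~~ sg q.
Proof. by rewrite /cv; case: (sg p); case: (sg q) => // /andP[? ?]; lra. Qed.

(** A tangent of slope at most -1 at [e] has everything on the left of [e] below it and everything
    on the right above it. *)
Lemma low_no_UW Q e : cvx Q -> pairwise (fun p q => -1 <= sl p q) Q -> e \in Q ->
  th e <= -1 -> forall p q, subseq [:: p; q] Q -> ~~ (sg p && ~~ sg q).
Proof.
move=> + + eQ le; case/splitPr: eQ => l r cQ gQ.
have [cl cr] := pw_split cQ; have [gl gr] := pw_split gQ.
move=> p q /subseq_catP[[|x P1] [P2 []]]; last first.
  case=> <- _ /mem_subseq/(_ p) pl _; have pin : p \in l by apply: pl; rewrite inE eqxx.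
  by rewrite negb_and (low_left (cl _ pin) (gl _ pin) le).
move=> /= <- _ sub; have qr : q \in r.
  move: sub => /=; case: eqP => _; first by rewrite sub1seq.
  by case/subseq2_mem.
by rewrite negb_and negbK (low_right (cr _ qr) (gr _ qr) le) orbT.
Qed.

(** Two points whose tangents have slope at most -1 are of type (W, U), so there are at most two of
    them. If there is one, no pair is of type (U, W), the other points have no pair of slope -1, and
    they form a cup, a cap or a small mixed set. *)
Lemma inner_bound Q : inner sl c B al be Q ->
  cvx Q -> med sl Q -> pairwise (fun p q => -1 <= sl p q) Q ->
  (0 < al)%N -> (0 < be)%N -> (al + be < B)%N -> (5 <= B)%N -> (size Q <= B)%N.
Proof.
move=> i cQ mQ gQ al0 be0 abB B5.
have aB : (al.+2 <= B)%N by apply: leq_trans abB; rewrite ltnS -addn1 leq_add2l.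
have bB : (be.+2 <= B)%N by apply: leq_trans abB; rewrite ltnS -add1n leq_add2r.
pose low p := th p <= -1.
have [/hasP[e eQ le]|nlow] := boolP (has low Q); last first.
  apply: inner_bound_high i cQ mQ B5 _ _ _ => [||p pQ].
  - exact: ltnW (ltnW aB).
  - exact: ltnW (ltnW bB).
  - by rewrite ltNge; apply/negP => lp; case/negP: nlow; apply/hasP; exists p.
have nUW := low_no_UW cQ gQ eQ le.
have lows : (size (seq.filter low Q) <= 2)%N.
  apply: (@alternating_le2 _ sg); apply/pwP => p q /subseq2_filter[lp lq sub].
  have [cpq gpq] := ((pwP _ _).2 cQ _ _ sub, (pwP _ _).2 gQ _ _ sub).
  by rewrite (negPf (low_left cpq gpq lq)) (low_right cpq gpq lp).
set Q' := seq.filter (predC low) Q.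
suff s' : (size Q' <= B - 2)%N.
  rewrite (size_filterC low); apply: leq_trans (leq_add lows s') _.
  by rewrite subnKC // (leq_trans _ B5).
have B2 : (2 <= B)%N by apply: leq_trans B5.
have sub' : subseq Q' Q by apply: filter_subseq.
have cQ' := subseq_pairwise sub' cQ.
have st : pairwise (fun p q => -1 < sl p q) Q'.
  apply/pwP => p q /subseq2_filter[hp hq sub]; rewrite ltNge; apply/negP => h.
  move: hp hq; rewrite /= /low -!ltNge => hp hq.
  by have := high_pair ((pwP _ _).2 cQ _ _ sub) hp hq h; apply/negP/nUW.
have i' := inner_subseq i sub'.
have [gU|ngU] := boolP (all sg Q').
  by apply: leq_trans (inner_cups i' cQ' st gU) _; rewrite leq_subRL // add2n.
have [gW|ngW] := boolP (all (predC sg) Q').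
  by apply: leq_trans (inner_caps i' cQ' st gW) _; rewrite leq_subRL // add2n.
apply: leq_trans (inner_mixed i' cQ' _ _ _) _.
- apply/pwP => p q sub; rewrite ((pwP _ _).2 st _ _ sub) implybT /=.
  by rewrite (negPf (nUW _ _ (subseq_trans sub sub'))).
- by move: ngW; rewrite all_predC negbK.
- by rewrite has_predC.
- by rewrite leq_subRL.
Qed.

End Inner.

(** Points in different parts are separated at a node on the path from the root to the leaf of [i],
    so their slope is flat. *)
Lemma up_decomp sl H B base h a b Q i : h <= H -> up sl H B base h a b Q -> i \in Q ->
  exists l C r a' b', [/\ Q = l ++ C ++ r, base a' b' C, i \in C &
    [/\ allrel (fun p q => sl p q < H) l C, allrel (fun p q => sl p q < H) C r &
        allrel (fun p q => sl p q < H) l r]].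
Proof.
move=> + u; elim: u => {h a b Q} [h a b Q bQ _ _ iQ|].
  by exists [::], Q, [::], a, b; rewrite cats0 allrel0r.
move=> h s a b a1 b1 a2 b2 Q1 Q2 _ IH1 _ IH2 sh hH x _ _ _ _ _ _.
have sH : s <= H by lra.
have x' : allrel (fun p q => sl p q < H) Q1 Q2.
  by apply: sub_allrel x => p q /andP[_ ?]; lra.
rewrite mem_cat => /orP[/(IH1 sH)|/(IH2 sH)] [l [C [r [a' [b' [e bC iC [f1 f2 f3]]]]]]].
  exists l, C, (r ++ Q2), a', b'; rewrite e !catA; split=> //.
  by move: x'; rewrite e !allrel_catl !allrel_catr f1 f2 f3 => /and3P[-> -> _].
exists (Q1 ++ l), C, r, a', b'; rewrite e !catA; split=> //.
by move: x'; rewrite e !allrel_catl !allrel_catr f1 f2 f3 => /and3P[_ -> ->].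
Qed.

(** * Convex sets in X[Y] *)

Section Outer.
Variables (sl : T -> T -> R) (th : T -> R) (sg : pred T) (m al be : nat).
Notation B := (al + be).+1.
Notation cvx := (pairwise (cv sl th sg)).
Notation flat := (pairwise (fun p q => sl p q < 0)).
Notation flatrel := (allrel (fun p q => sl p q < 0)).
Notation block := (block sl m al be).
Notation outer := (up sl 0 B block).
Notation low := (pairwise (fun p q => -1 <= sl p q)).

Lemma outer_subseq h a b Q Q' : outer h a b Q -> subseq Q' Q -> outer h a b Q'.
Proof. by apply: up_subseq => *; apply: block_subseq; eassumption. Qed.

Lemma block_flat a b Q : block a b Q -> cvx Q -> flat Q ->
  [/\ (size Q <= a)%N, (size Q <= b)%N & (size Q <= 2)%N].
Proof.
move=> [c [ca cb _ i]] cQ f; have s := inner_flat i cQ f.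
by rewrite !(leq_trans s) // geq_minr.
Qed.

(** The points of U form a flat convex set, so they lie in one collinear leaf and number at most
    two; likewise those of W. *)
Lemma block_same_sign a b Q : block a b Q -> cvx Q ->
  pairwise (fun p q => (sg p == sg q) ==> (sl p q < 0)) Q -> (size Q <= 4)%N.
Proof.
move=> bQ cQ /pwP f; rewrite (size_filterC sg) -[4%N]/(2 + 2)%N.
apply: leq_add.
  have sub := filter_subseq sg Q.
  have [|_ _ s] := block_flat (block_subseq bQ sub) (subseq_pairwise sub cQ); last exact: s.
  by apply/pwP => p q /subseq2_filter[gp gq /f]; rewrite gp gq.
have sub := filter_subseq (predC sg) Q.
have [|_ _ s] := block_flat (block_subseq bQ sub) (subseq_pairwise sub cQ); last exact: s.
by apply/pwP => p q /subseq2_filter[/negPf gp /negPf gq /f]; rewrite gp gq.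
Qed.

Lemma outer_cups h a b Q : outer h a b Q -> cvx Q -> flat Q -> all sg Q -> (size Q <= a)%N.
Proof. by apply: cups_bound => ? ? ? bQ cQ fQ _; have [] := block_flat bQ cQ fQ. Qed.

Lemma outer_caps h a b Q : outer h a b Q -> cvx Q -> flat Q -> all (predC sg) Q ->
  (size Q <= b)%N.
Proof. by apply: caps_bound => ? ? ? bQ cQ fQ _; have [] := block_flat bQ cQ fQ. Qed.

Lemma outer_mixed h a b P Q : outer h a b (P ++ Q) -> cvx (P ++ Q) -> flat (P ++ Q) ->
  all sg P -> all (predC sg) Q -> P != [::] -> Q != [::] -> (size P + size Q <= 3)%N.
Proof.
move=> u c f gP gQ /nonempty_mem[p pP] /nonempty_mem[q qQ]; rewrite -size_cat.
pose r p q := (sl p q < 0) && (sg q ==> sg p).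
apply: (mixed_bound (r := r) _ _ _ u c) => //.
- by move=> x y /andP[f' /implyP g]; split=> // /negP n /g.
- move=> a' b' S bS cS rS; have [|_ _ s] := block_flat bS cS.
    by apply: sub_pairwise rS => x y /andP[].
  exact: leq_trans s _.
- move: f; rewrite !pairwise_cat => /and3P[/allrelP f1 /pwP f2 /pwP f3].
  apply/and3P; split.
  + by apply/allrelP => x y xP yQ; rewrite /r f1 // (allP gP _ xP) implybT.
  + apply/pwP => x y sub; have [xP _] := subseq2_mem sub.
    by rewrite /r f2 // (allP gP _ xP) implybT.
  + apply/pwP => x y sub; have [_ yQ] := subseq2_mem sub.
    by rewrite /r f3 // (negPf (allP gQ _ yQ)).
- by rewrite has_cat; apply/orP; left; apply/hasP; exists p; rewrite ?(allP gP).
- by rewrite has_cat; apply/orP; right; apply/hasP; exists q; rewrite ?(allP gQ).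
Qed.

Lemma steep_left i p : 0 <= th i -> cv sl th sg p i -> sl p i < 0 -> sg p.
Proof. by rewrite /cv; case: (sg p); case: (sg i) => // ? /andP[? ?]; lra. Qed.

Lemma steep_right i p : 0 <= th i -> cv sl th sg i p -> sl i p < 0 -> ~~ sg p.
Proof. by rewrite /cv; case: (sg p); case: (sg i) => // ? /andP[? ?]; lra. Qed.

Lemma cups_flat Q : cvx Q -> all sg Q -> {in Q, forall p, th p < 0} -> flat Q.
Proof.
move=> /pwP c /allP g t; apply/pwP => p q sub; have [pQ qQ] := subseq2_mem sub.
by have := c _ _ sub; rewrite /cv !g //; move: (t _ qQ) => ? /andP[]; lra.
Qed.

Lemma caps_flat Q : cvx Q -> all (predC sg) Q -> {in Q, forall p, th p < 0} -> flat Q.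
Proof.
move=> /pwP c /allP g t; apply/pwP => p q sub; have [pQ qQ] := subseq2_mem sub.
have := c _ _ sub; rewrite /cv (negPf (g _ pQ)) (negPf (g _ qQ)).
by move: (t _ pQ) => ? /andP[]; lra.
Qed.

(** The reflected slopes of Y are below 0 or at least 1, which leaves a gap between -1 and 0. *)
Lemma steep_cross a b C p q : block a b C -> subseq [:: p; q] C ->
  -1 < sl p q -> 0 < sl p q.
Proof.
move=> [c [_ _ _ /up_pair]]; rewrite pairwise_rev => /pwP f /f.
by rewrite /opp_sl => /orP[]; lra.
Qed.

Lemma block_cups a b C : block a b C -> cvx C -> {in C, forall p, -1 < th p} ->
  all sg C -> (size C <= al)%N.
Proof.
move=> [c [_ _ _ i]] cC t g; apply: (inner_cups i cC _ g).
apply/pwP => p q sub; have [pC qC] := subseq2_mem sub.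
have := (pwP _ _).2 cC _ _ sub; rewrite /cv !(allP g _ _) //.
by have := t _ pC; move=> ? /andP[]; lra.
Qed.

Lemma block_caps a b C : block a b C -> cvx C -> {in C, forall p, -1 < th p} ->
  all (predC sg) C -> (size C <= be)%N.
Proof.
move=> [c [_ _ _ i]] cC t g; apply: (inner_caps i cC _ g).
apply/pwP => p q sub; have [pC qC] := subseq2_mem sub.
have := (pwP _ _).2 cC _ _ sub.
rewrite /cv (negPf (allP g _ pC)) (negPf (allP g _ qC)).
by have := t _ qC; move=> ? /andP[]; lra.
Qed.

(* Two copies of Y with steep tangents: by [outer_mixed] at most one further point
   is used, and the first copy contributes a cup, the second a cap. *)
Lemma two_steep_bound h a b a1 b1 a2 b2 l C mid D r i j :
  outer h a b (l ++ C ++ mid ++ D ++ r) -> cvx (l ++ C ++ mid ++ D ++ r) ->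
  low (l ++ C ++ mid ++ D ++ r) -> block a1 b1 C -> block a2 b2 D ->
  i \in C -> 0 <= th i -> j \in D -> 0 <= th j ->
  flatrel l (C ++ D ++ r) -> flatrel C (mid ++ D ++ r) -> flatrel mid D -> flatrel D r ->
  (size (l ++ C ++ mid ++ D ++ r) <= B)%N.
Proof.
move=> u cQ gQ bC bD iC ti jD tj.
rewrite !allrel_catr => /and3P[/allrelP flC /allrelP flD /allrelP flr].
move=> /and3P[/allrelP fCm /allrelP fCD /allrelP fCr] /allrelP fmD /allrelP fDr.
have cP X Y : subseq (X ++ Y) (l ++ C ++ mid ++ D ++ r) ->
    forall p q, p \in X -> q \in Y -> cv sl th sg p q /\ -1 <= sl p q.
  move=> sub p q pX qY; have sub2 : subseq [:: p; q] (X ++ Y).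
    by rewrite (@cat_subseq _ [:: p] [:: q]) // sub1seq.
  have sub' := subseq_trans sub2 sub.
  by split; [exact: (pwP _ _).2 cQ _ _ sub'|exact: (pwP _ _).2 gQ _ _ sub'].
have sCmDr : subseq (C ++ mid ++ D ++ r) (l ++ C ++ mid ++ D ++ r) by apply: suffix_subseq.
have sCDr : subseq (C ++ D ++ r) (C ++ mid ++ D ++ r).
  by rewrite subseq_cat2l suffix_subseq.
have clC := cP l C (cat_subseq (subseq_refl l) (prefix_subseq C _)).
have cCm := cP C mid (subseq_trans (cat_subseq (subseq_refl C) (prefix_subseq mid _)) sCmDr).
have cCD := cP C D (subseq_trans (subseq_trans (cat_subseq (subseq_refl C) (prefix_subseq D r)) sCDr) sCmDr).
have cCr := cP C r (subseq_trans (subseq_trans (cat_subseq (subseq_refl C) (suffix_subseq D r)) sCDr) sCmDr).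
have smDr : subseq (mid ++ D ++ r) (l ++ C ++ mid ++ D ++ r).
  exact: subseq_trans (suffix_subseq _ _) (suffix_subseq _ _).
have cmD := cP mid D (subseq_trans (cat_subseq (subseq_refl mid) (prefix_subseq D r)) smDr).
have sDr : subseq (D ++ r) (l ++ C ++ mid ++ D ++ r).
  exact: subseq_trans (suffix_subseq _ _) smDr.
have cDr := cP D r sDr.
have gC : all sg C.
  by apply/allP => p pC; apply: (steep_left tj (cCD _ _ pC jD).1 (fCD _ _ pC jD)).
have gD : all (predC sg) D.
  by apply/allP => p pD; apply: (steep_right ti (cCD _ _ iC pD).1 (fCD _ _ iC pD)).
have gl : all sg l.
  by apply/allP => p pl; apply: (steep_left ti (clC _ _ pl iC).1 (flC _ _ pl iC)).
have gr : all (predC sg) r.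
  by apply/allP => p pr; apply: (steep_right tj (cDr _ _ jD pr).1 (fDr _ _ jD pr)).
(* A point of [mid] would be in U, being left of [j], and in W, being right of [i]. *)
have m0 : mid = [::].
  case: (mid) cCm fCm cmD fmD => // p mid' c1 f1 c2 f2; have pm := mem_head p mid'.
  have := steep_left tj (c2 _ _ pm jD).1 (f2 _ _ pm jD).
  by rewrite (negPf (steep_right ti (c1 _ _ iC pm).1 (f1 _ _ iC pm))).
have tl : {in l, forall p, th p < 0}.
  move=> p pl; rewrite ltNge; apply/negP => tp.
  by have := steep_right tp (clC _ _ pl iC).1 (flC _ _ pl iC); rewrite (allP gC _ iC).
have tr : {in r, forall p, th p < 0}.
  move=> p pr; rewrite ltNge; apply/negP => tp; have := allP gD _ jD.
  by rewrite /= (steep_left tp (cDr _ _ jD pr).1 (fDr _ _ jD pr)).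
(* One point of each copy together with [l] and [r] is a flat set of type U followed by W; having at
   most three points, it leaves at most one for [l] and [r] together. *)
have sub4 : subseq ((l ++ [:: i]) ++ (j :: r)) (l ++ C ++ mid ++ D ++ r).
  rewrite -catA subseq_cat2l; apply: subseq_trans sCDr.
  by rewrite (@cat_subseq _ [:: i]) ?sub1seq // (@cat_subseq _ [:: j]) ?sub1seq.
have [cl cC cD cr] : [/\ cvx l, cvx C, cvx D & cvx r].
  by move: cQ; rewrite !pairwise_cat => /and3P[_ -> /and3P[_ -> /and3P[_ _ /and3P[_ -> ->]]]].
have s3 : (size (l ++ [:: i]) + size (j :: r) <= 3)%N.
  have [u' c'] := (outer_subseq u sub4, subseq_pairwise sub4 cQ).
  apply: (outer_mixed u' c').
  - rewrite !pairwise_cat /= (cups_flat cl gl tl) (caps_flat cr gr tr) !andbT.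
    apply/and3P; split.
    + apply/allrelP => p q; rewrite mem_cat !inE => /orP[pl|/eqP->] /orP[/eqP->|qr].
      * exact: flD. * exact: flr. * exact: fCD. * exact: fCr.
    + by apply/allrelP => p q pl; rewrite inE => /eqP->; apply: flC.
    + by apply/allP => q; apply: fDr.
  - by rewrite all_cat gl /= (allP gC _ iC).
  - by apply/andP; split=> //; apply: (allP gD _ jD).
  - by case: (l).
  - by [].
have sC : (size C <= al)%N.
  apply: block_cups bC cC _ gC => p pC; rewrite ltNge; apply/negP => tp.
  have [c' g'] := cCD _ _ pC jD.
  by have := low_right c' g' tp; apply/negP; apply: (allP gD _ jD).
have sD : (size D <= be)%N.
  apply: block_caps bD cD _ gD => p pD; rewrite ltNge; apply/negP => tp.
  have [c' g'] := cCD _ _ iC pD.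
  by have := low_left c' g' tp; rewrite (allP gC _ iC).
rewrite m0 !size_cat /=; move: s3 sC sD; rewrite size_cat /=; clear; lia.
Qed.

(** Here [l] is in U and [r] in W. If [C] is a cup and [r] is empty, then [l] with one point of [C]
    is a cup of X, which gives [al + (a - 1)] points and explains [a <= be + 2]; caps are symmetric.
    Otherwise, unless [l] and [r] are both empty, they have at most two points together, and a mixed
    [C] has at most three. *)
Lemma one_steep_bound h a b a1 b1 l C r i :
  outer h a b (l ++ C ++ r) -> cvx (l ++ C ++ r) -> low (l ++ C ++ r) ->
  med sl (l ++ C ++ r) -> block a1 b1 C -> i \in C -> 0 <= th i ->
  flatrel l C -> flatrel C r -> flatrel l r ->
  {in l, forall p, th p < 0} -> {in r, forall p, th p < 0} ->
  (a <= be + 2)%N -> (b <= al + 2)%N -> (0 < al)%N -> (0 < be)%N -> (4 <= al + be)%N ->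
  (size (l ++ C ++ r) <= B)%N.
Proof.
move=> u cQ gQ mQ bC iC ti /allrelP flC /allrelP fCr /allrelP flr tl tr ab ba al0 be0 B5.
have := cQ; rewrite !pairwise_cat allrel_catr.
move=> /and3P[/andP[/allrelP clC /allrelP clr] cl /and3P[/allrelP cCr cC cr]].
have := gQ; rewrite !pairwise_cat allrel_catr.
move=> /and3P[/andP[/allrelP glC /allrelP glr] _ /and3P[/allrelP gCr gC _]].
have gl : all sg l.
  by apply/allP => p pl; apply: (steep_left ti (clC _ _ pl iC) (flC _ _ pl iC)).
have gr : all (predC sg) r.
  by apply/allP => p pr; apply: (steep_right ti (cCr _ _ iC pr) (fCr _ _ iC pr)).
have [l0|nlr] := boolP ((l == [::]) && (r == [::])).
  have mC : med sl C.
    by apply: med_subseq mQ; apply: subseq_trans (suffix_subseq _ _); apply: prefix_subseq.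
  case/andP: l0 => /eqP-> /eqP->; rewrite cats0.
  by case: bC => c [_ _ _ iC']; apply: (inner_bound iC' cC mC gC al0 be0).
have tC : {in C, forall p, -1 < th p}.
  move=> p pC; rewrite ltNge; apply/negP => tp; case/nandP: nlr => /nonempty_mem[e eQ].
    by have := low_left (clC _ _ eQ pC) (glC _ _ eQ pC) tp; rewrite (allP gl _ eQ).
  by have := allP gr _ eQ; rewrite /= (low_right (cCr _ _ pC eQ) (gCr _ _ pC eQ) tp).
have [fl fr] := (cups_flat cl gl tl, caps_flat cr gr tr).
have subx x : x \in C -> subseq (l ++ x :: r) (l ++ C ++ r).
  by move=> xC; rewrite subseq_cat2l (@cat_subseq _ [:: x]) ?sub1seq.
have flatx x : x \in C -> flat (l ++ x :: r).
  move=> xC; rewrite pairwise_cat allrel_consr /= fl fr !andbT -andbA; apply/and3P; split.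
  - by apply/allP => p pl; apply: flC.
  - by apply/allrelP.
  - by apply/allP => p pr; apply: fCr.
have ux x (xC : x \in C) := outer_subseq u (subx x xC).
have cx x (xC : x \in C) := subseq_pairwise (subx x xC) cQ.
have NU x : x \in C -> sg x -> r != [::] -> (size l + size r <= 2)%N.
  move=> xC gx nr; have := ux x xC; have := cx x xC; have := flatx x xC.
  rewrite -cat_rcons => f' c' u'.
  have g : all sg (rcons l x) by rewrite all_rcons gx.
  have nl : rcons l x != [::] by case: (l).
  by have := outer_mixed u' c' f' g gr nl nr; rewrite size_rcons; clear; lia.
have NW x : x \in C -> ~~ sg x -> l != [::] -> (size l + size r <= 2)%N.
  move=> xC gx nl; have := outer_mixed (ux x xC) (cx x xC) (flatx x xC).
  by rewrite /= gx gl gr nl => /(_ isT isT isT isT); clear; lia.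
have [gCU|nCU] := boolP (all sg C).
  have sC := block_cups bC cC tC gCU; have [r0|nr] := eqVneq r [::].
    have := outer_cups (ux i iC) (cx i iC) (flatx i iC).
    rewrite r0 all_cat gl /= (allP gCU _ iC) cats0 !size_cat /= => /(_ isT).
    move: sC ab; clear; lia.
  have := NU i iC (allP gCU _ iC) nr; rewrite !size_cat.
  move: sC be0; clear; lia.
have [gCW|nCW] := boolP (all (predC sg) C).
  have sC := block_caps bC cC tC gCW; have [l0|nl] := eqVneq l [::].
    have := outer_caps (ux i iC) (cx i iC) (flatx i iC).
    have gi : ~~ sg i := allP gCW _ iC.
    rewrite l0 /= gr gi !size_cat /= => /(_ isT).
    move: sC ba; clear; lia.
  have := NW i iC (allP gCW _ iC) nl; rewrite !size_cat.
  move: sC al0; clear; lia.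
have hU : has sg C by rewrite -[has sg C]negbK -all_predC.
have hW : has (predC sg) C by rewrite has_predC.
have slr : (size l + size r <= 2)%N.
  have [[x xC gx] [y yC gy]] := (hasP hU, hasP hW).
  have [r0|nr] := eqVneq r [::]; last exact: NU xC gx nr.
  by apply: NW yC gy _; move: nlr; rewrite r0 andbT.
suff sC : (size C <= 3)%N by rewrite !size_cat; move: slr sC B5; clear; lia.
case: (bC) => c [_ _ _ iC']; apply: (inner_mixed iC' cC _ hU hW).
apply/pwP => p q sub; have [pC qC] := subseq2_mem sub.
have cpq := (pwP _ _).2 cC _ _ sub; apply/andP; split; apply/implyP.
  move=> /eqP e; rewrite ltNge; apply/negP => h'.
  by have := high_pair cpq (tC _ pC) (tC _ qC) h'; rewrite e andbN.
(* A pair (U, W) of positive slope is excluded by any point [e] outside [C]. For [e] on the left,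
   [sl e q < th e < sl e p], while [med] and [sl e q < 0 < sl p q] give [sl e p <= sl e q]. *)
move=> /andP[gp gq]; rewrite leNgt; apply/negP => /(steep_cross bC sub) st.
case/nandP: nlr => /nonempty_mem[e eQ].
  have sub3 : subseq [:: e; p; q] (l ++ C ++ r).
    rewrite (@cat_subseq _ [:: e]) ?sub1seq //.
    exact: subseq_trans sub (prefix_subseq _ _).
  have := clC _ _ eQ pC; have := clC _ _ eQ qC; have := flC _ _ eQ qC.
  rewrite /cv (allP gl _ eQ) gp (negPf gq) => ? /andP[? ?] /andP[? ?].
  by case/orP: (mQ _ _ _ sub3) => /andP[? ?]; lra.
have sub3 : subseq [:: p; q; e] (l ++ C ++ r).
  apply: subseq_trans (suffix_subseq _ _).
  by rewrite (@cat_subseq _ [:: p; q]) // sub1seq.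
have := cCr _ _ pC eQ; have := cCr _ _ qC eQ; have := fCr _ _ pC eQ.
rewrite /cv (negPf (allP gr _ eQ)) gp (negPf gq) => ? /andP[? ?] /andP[? ?].
by case/orP: (mQ _ _ _ sub3) => /andP[? ?]; lra.
Qed.

(** The cases are: no tangent of slope at least 0, such tangents in one copy of Y only, or in two
    copies. *)
Lemma outer_bound h a b Q : h <= 0 -> outer h a b Q -> cvx Q -> low Q -> med sl Q ->
  (a <= be + 2)%N -> (b <= al + 2)%N -> (0 < al)%N -> (0 < be)%N -> (4 <= al + be)%N ->
  (size Q <= B)%N.
Proof.
move=> h0 u cQ gQ mQ ab ba al0 be0 B5.
pose steep p := 0 <= th p.
have [/hasP[i iQ ti]|ns] := boolP (has steep Q); last first.
  apply: (flat_tangent_bound _ _ _ _ _ _ u cQ mQ) 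
    => [a' b' P bP cP fP _|a' b' P bP cP fP _|a' b' P bP cP fP|//|||p pQ].
  - by have [] := block_flat bP cP fP.
  - by have [] := block_flat bP cP fP.
  - exact: block_same_sign bP cP fP.
  - by move: ab al0; clear; lia.
  - by move: ba be0; clear; lia.
  - by rewrite ltNge; apply/negP => tp; case/negP: ns; apply/hasP; exists p.
have [l [C [r [a1 [b1 [eQ bC iC [flC fCr flr]]]]]]] := up_decomp h0 u iQ.
subst Q.
have ul : outer h a b l by apply: outer_subseq u _; apply: prefix_subseq.
have ur : outer h a b r.
  apply: outer_subseq u _.
  exact: subseq_trans (suffix_subseq C r) (suffix_subseq l _).
have [/hasP[j jr tj]|nr] := boolP (has steep r).
  have [l2 [D [r2 [a2 [b2 [er bD jD [f1 f2 f3]]]]]]] := up_decomp h0 ur jr.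
  move: flr fCr; rewrite er !allrel_catr => /and3P[fl1 fl2 fl3] /and3P[fC1 fC2 fC3].
  subst r; apply: (two_steep_bound u cQ gQ bC bD iC ti jD tj) => //.
    by rewrite !allrel_catr flC fl2.
  by rewrite !allrel_catr fC1 fC2.
have [/hasP[j jl tj]|nl] := boolP (has steep l).
  have [l2 [D [r2 [a2 [b2 [el bD jD [f1 f2 f3]]]]]]] := up_decomp h0 ul jl.
  move: flr flC; rewrite el !allrel_catl => /and3P[fl1 fl2 fl3] /and3P[fC1 fC2 fC3].
  subst l; rewrite -!catA in u cQ gQ *.
  apply: (two_steep_bound u cQ gQ bD bC jD tj iC ti) => //.
    by rewrite !allrel_catr f1 fC1.
  by rewrite !allrel_catr f2 fC2.
apply: (one_steep_bound u cQ gQ mQ bC iC ti) => // p pQ; rewrite ltNge; apply/negP => tp.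
  by case/negP: nl; apply/hasP; exists p.
by case/negP: nr; apply/hasP; exists p.
Qed.

End Outer.
End TwoLevels.

(** * Construction of the point sets *)

Section Plane.
Context {R : realFieldType}.
Notation pt := (R * R)%type.
Implicit Types (p q : pt) (P Q : seq pt).

Definition slope p q : R := (q.2 - p.2) / (q.1 - p.1).

Definition ordered P := pairwise (fun p q : pt => p.1 < q.1) P.
Definition low_slopes P := pairwise (fun p q => -1 <= slope p q) P.

Lemma slope_gt p q u : p.1 < q.1 -> (u < slope p q) = (u * (q.1 - p.1) < q.2 - p.2).
Proof. by move=> h; rewrite /slope ltr_pdivlMr // subr_gt0. Qed.

Lemma slope_lt p q u : p.1 < q.1 -> (slope p q < u) = (q.2 - p.2 < u * (q.1 - p.1)).
Proof. by move=> h; rewrite /slope ltr_pdivrMr // subr_gt0. Qed.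

Lemma slopeE p q : p.1 < q.1 -> slope p q * (q.1 - p.1) = q.2 - p.2.
Proof. by move=> h; rewrite /slope divfK // subr_eq0 gt_eqF. Qed.

Lemma ordered_med P : ordered P -> med slope P.
Proof.
move=> /pwP o p q r sub.
have pq : p.1 < q.1.
  by apply: o; apply: subseq_trans sub; rewrite (prefix_subseq [:: p; q] [:: r]).
have qr : q.1 < r.1.
  by apply: o; apply: subseq_trans sub; rewrite (suffix_subseq [:: p] [:: q; r]).
have pr : p.1 < r.1 by apply: lt_trans qr.
have := slopeE pq; have := slopeE qr; have := slopeE pr.
move: (slope p q) (slope q r) (slope p r) => a b c e1 e2 e3.
(* The widths being positive, [c - a] and [b - c] have the same sign. *)
have e : (c - a) * (q.1 - p.1) = (b - c) * (r.1 - q.1) by lra.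
have [x1 x2] : 0 < q.1 - p.1 /\ 0 < r.1 - q.1 by rewrite !subr_gt0.
have [ac|/ltW ca] := lerP a c; apply/orP; [left|right]; rewrite ?ac ?ca ?andbT /=.
  by rewrite -subr_ge0 -(pmulr_lge0 _ x2) -e mulr_ge0 ?subr_ge0 // ltW.
by rewrite -subr_le0 -(pmulr_lle0 _ x2) -e mulr_le0_ge0 ?(ltW x1) // subr_le0.
Qed.

(* Being placeable in every box allows gluing two configurations with prescribed
   slopes between them, by placing them in boxes small compared to their distance. *)
Definition placeable (N : nat) (C : seq pt -> Prop) : Prop :=
  forall x y e : R, 0 < e -> exists P, [/\ size P = N, C P, ordered P /\ low_slopes P &
    {in P, forall p, `|p.1 - x| < e /\ `|p.2 - y| < e}].

Lemma placeable_imp N (C C' : seq pt -> Prop) :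
  (forall P, C P -> C' P) -> placeable N C -> placeable N C'.
Proof.
by move=> i h x y e e0; have [P [s /i c o b]] := h x y e e0; exists P.
Qed.

Lemma placeable_leaf d N : -1 <= d <= 1 ->
  placeable N (fun P => size P = N /\ pairwise (fun p q => slope p q == d) P).
Proof.
move=> /andP[d1 d2] x y e e0; pose z : R := e / N.+1%:R.
have z0 : 0 < z by rewrite divr_gt0 // ltr0n.
pose f i : pt := (x + z * i%:R, y + d * (z * i%:R)).
have fx i j : (i < j)%N -> (f i).1 < (f j).1.
  by move=> ij; rewrite /= ltrD2l ltr_pM2l // ltr_nat.
have fs i j : (i < j)%N -> slope (f i) (f j) = d.
  move=> ij; have x0 : (f j).1 - (f i).1 != 0 by rewrite subr_eq0 gt_eqF // fx.
  by apply: (mulIf x0); rewrite slopeE ?fx //=; ring.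
have pw (r : rel pt) : (forall i j, (i < j)%N -> r (f i) (f j)) -> pairwise r (mkseq f N).
  move=> h; rewrite pairwise_map.
  apply: (sub_pairwise (r := ltn)) => [i j|]; first exact: h.
  by rewrite -sorted_pairwise ?iota_ltn_sorted //; apply: ltn_trans.
exists (mkseq f N); split.
- by rewrite size_mkseq.
- by rewrite size_mkseq; split=> //; apply: pw => i j /fs->.
- by split; apply: pw => i j ij; rewrite ?fx ?fs.
- move=> p /mapP[i]; rewrite mem_iota add0n => /andP[_ iN] ->.
  have zi : 0 <= z * i%:R < e.
    rewrite mulr_ge0 ?ler0n ?ltW //= /z mulrAC ltr_pdivrMr ?ltr0n //.
    by rewrite ltr_pM2l // ltr_nat ltnS ltnW.
  move: zi => /=; move: (z * _) => t /andP[t0 te]; rewrite ![_ + _ - _]addrAC !subrr !add0r.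
  rewrite ger0_norm //; split=> //; rewrite normrM (ger0_norm t0).
  by apply: le_lt_trans te; rewrite ler_piMl // ler_norml d1.
Qed.

Lemma placeable_glue u v N1 N2 (C1 C2 : seq pt -> Prop) : -1 <= u -> u < v ->
  placeable N1 C1 -> placeable N2 C2 ->
  placeable (N1 + N2) (fun P => exists P1 P2, [/\ P = P1 ++ P2, C1 P1, C2 P2 &
    allrel (fun p q => (u < slope p q) && (slope p q < v)) P1 P2]).
Proof.
move=> u1 uv E1 E2 x y e e0.
have [u0 v0] := (normr_ge0 u, normr_ge0 v).
(* The second box is centred in direction [(u + v) / 2] from the first. The choice of [z] keeps both
   boxes inside the given one, and [t] makes the errors, at most [2 * M * t], smaller than the slack
   [z * (v - u) / 2]. *)
pose M : R := 1 + `|u| + `|v|; have M0 : 0 < M by rewrite /M; lra.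
pose z : R := e / (2 * M); have z0 : 0 < z by rewrite divr_gt0 // mulr_gt0.
pose t : R := z * (v - u) / (8 * M).
have t0 : 0 < t by apply: divr_gt0; apply: mulr_gt0; rewrite ?subr_gt0.
have zM : 2 * (M * z) = e by rewrite /z; field; rewrite gt_eqF.
have tM : 8 * (M * t) = z * (v - u) by rewrite /t; field; rewrite gt_eqF.
have [nu nv] := (ler_norm u, ler_norm v).
have [nu' nv'] : - u <= `|u| /\ - v <= `|v| by split; apply: le_trans (ler_norm _) _; rewrite normrN.
have M1 : 1 <= M by rewrite /M; lra.
have uvM : v - u <= M by rewrite /M; lra.
have [P1 [s1 c1 [ord1 l1] b1]] := E1 x y t t0.
have [P2 [s2 c2 [ord2 l2] b2]] := E2 (x + z) (y + z * ((u + v) / 2)) t t0.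
have tz : 8 * t <= z.
  by rewrite -(ler_pM2l M0) mulrCA tM mulrC ler_wpM2r // ltW.
have x12 : allrel (fun p q : pt => p.1 < q.1) P1 P2.
  apply/allrelP => p q /b1[+ _] /b2[+ _]; rewrite !ltr_norml.
  by move=> /andP[? ?] /andP[? ?]; lra.
have bound (w r : R) : `|w| <= M - 1 -> `|r| <= 2 * t -> `|w * r| <= (M - 1) * (2 * t).
  by move=> ? ?; rewrite normrM ler_pM.
have cross : allrel (fun p q => (u < slope p q) && (slope p q < v)) P1 P2.
  apply/allrelP => p q pP qP; have pq := allrelP x12 _ _ pP qP.
  rewrite slope_gt ?slope_lt //; move: (b1 _ pP) (b2 _ qP) => [+ +] [+ +].
  rewrite !ltr_norml => /andP[? ?] /andP[? ?] /andP[? ?] /andP[? ?].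
  pose r := q.1 - p.1 - z; have r2 : `|r| <= 2 * t by rewrite /r ler_norml; apply/andP; split; lra.
  have bu : `|u * r| <= (M - 1) * (2 * t).
    by apply: bound r2; rewrite /M; lra.
  have bv : `|v * r| <= (M - 1) * (2 * t).
    by apply: bound r2; rewrite /M; lra.
  have -> : q.1 - p.1 = z + r by rewrite /r; ring.
  have Mt : 0 < M * t by rewrite mulr_gt0.
  move: bu bv; rewrite !ler_norml !mulrDr !mulrBl !mul1r => /andP[bu1 bu2] /andP[bv1 bv2].
  apply/andP; split; lra.
exists (P1 ++ P2); split; first by rewrite size_cat s1 s2.
- by exists P1, P2.
- split; rewrite /ordered /low_slopes pairwise_cat; apply/and3P; split=> //.
  by apply: sub_allrel cross => p q /andP[h _]; apply: le_trans u1 (ltW h).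
- have e2 : e / 2 = M * z by rewrite -zM mulrC mulKf ?pnatr_eq0.
  have ez : z <= e / 2 by rewrite e2; apply: ler_peMl; [exact: (ltW z0)|exact: M1].
  have zs : `|z * ((u + v) / 2)| <= e / 2.
    rewrite e2 normrM (gtr0_norm z0) mulrC ler_wpM2r ?(ltW z0) //.
    by rewrite ler_norml /M; apply/andP; split; lra.
  move: zs; rewrite ler_norml => /andP[? ?].
  move=> p; rewrite mem_cat => /orP[/b1|/b2]; rewrite !ltr_norml => -[/andP[? ?] /andP[? ?]];
  by split; apply/andP; split; lra.
Qed.

End Plane.

(** Pascal's rule is the recursion for the size of an Erdős-Szekeres tree whose leaves have weight
    [w]. *)
Lemma binomial_tree (F : nat -> nat -> nat -> Prop) w :
  (forall a, F w a 0%N) -> (forall b, F w 0%N b) ->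
  (forall N1 N2 a b, F N1 a b.+1 -> F N2 a.+1 b -> F (N1 + N2)%N a.+1 b.+1) ->
  forall a b, F (w * 'C(a + b, a))%N a b.
Proof.
move=> Fl Fr FN a b; move e : (a + b)%N => n; rewrite -e.
elim: n a b e => [|n IH] [|a] [|b] // e; rewrite ?addn0 ?binn ?add0n ?bin0 ?muln1 //.
have -> : (w * 'C(a.+1 + b.+1, a.+1) =
    w * 'C(a + b.+1, a) + w * 'C(a.+1 + b, a.+1))%N.
  by rewrite -mulnDr addSn binS addnC addSnnS.
by apply: FN; apply: IH; move: e; clear; lia.
Qed.

(** * Placing the trees X and Y in the plane *)

Section Build.
Context {R : realFieldType}.
Notation pt := (R * R)%type.
Notation sl := (@slope R).

Lemma placeable_inner c B a b h : (a.+1 + b.+1 <= B)%N -> h <= 1 ->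
  placeable (c * 'C(a + b, a)) (fun P : seq pt =>
    up (opp_sl sl) 1 B (leaf (opp_sl sl) c) h a.+1 b.+1 (rev P)).
Proof.
move=> + h1; move: a b h h1.
pose F N a b := forall h : R, h <= 1 -> (a.+1 + b.+1 <= B)%N -> placeable N (fun P : seq pt =>
    up (opp_sl sl) 1 B (leaf (opp_sl sl) c) h a.+1 b.+1 (rev P)).
suff H a b : F (c * 'C(a + b, a))%N a b by move=> *; apply: H.
have base a' b' h : placeable c (fun P : seq pt =>
    up (opp_sl sl) 1 B (leaf (opp_sl sl) c) h a'.+1 b'.+1 (rev P)).
  have m1 : (-1 <= -1 :> R) && (-1 <= 1 :> R) by rewrite lexx /=; lra.
  apply: placeable_imp (placeable_leaf c m1) => P [s e].
  have e' : pairwise (fun p q => opp_sl sl p q == 1) (rev P).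
    by rewrite pairwise_rev; apply: sub_pairwise e => p q /eqP e; rewrite /opp_sl e opprK.
  apply: up_base; first by split; rewrite ?size_rev ?s.
  by apply: sub_pairwise e' => p q /eqP->; rewrite lexx orbT.
apply: (binomial_tree (F := F)) => [a' h _ _|b' h _ _|N1 N2 a' b' IH1 IH2 h h1 ab]; try exact: base.
have h0 : -1 <= - h by lra.
have hh : - h < 1 - h by lra.
have hs : h - 1 <= 1 by lra.
have sB : (a'.+1 + b'.+2 <= B)%N by move: ab; clear; lia.
have sB' : (a'.+2 + b'.+1 <= B)%N by move: ab; clear; lia.
(* The right half of the reflected tree is placed on the left. Slopes across lie between [- h] and
   [1 - h], hence between [h - 1] and [h] after reflection. *)
rewrite addnC; apply: placeable_imp (placeable_glue h0 hh (IH2 _ hs sB') (IH1 _ hs sB)).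
move=> P [P1 [P2 [-> u1 u2 x]]]; rewrite rev_cat.
apply: (up_node u2 u1) => //; first by lra.
- rewrite allrel_rev2 allrelC; apply: sub_allrel x => p q /andP[? ?].
  by rewrite /opp_sl; apply/andP; split; lra.
- by move: ab; clear; lia.
Qed.

Section Outer.
Variables (m al be : nat).
Notation AY := 'C(al + be, al).
Notation outer := (up sl 0 (al.+1 + be.+1).+1 (block sl m al.+1 be.+1)).

Lemma placeable_block c a b h : -1 < h -> (c <= m)%N ->
  (minn c 2 <= a)%N -> (minn c 2 <= b)%N ->
  placeable (c * AY) (outer h a b).
Proof.
move=> h1 cm ca cb.
have i := @placeable_inner c (al.+1 + be.+1).+1 al be 0 (leqnSn _) ler01.
apply: placeable_imp i => P i; apply: up_base; first by exists c.
have := up_pair i; rewrite pairwise_rev; apply: sub_pairwise => p q.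
by rewrite /opp_sl => /orP[?|?]; apply/orP; [right|left]; lra.
Qed.

Lemma placeable_outer N1 N2 h a b a1 b1 a2 b2 : -1 < h -> h <= 0 ->
  (forall s, -1 < s -> s <= 0 -> placeable N1 (outer s a1 b1)) ->
  (forall s, -1 < s -> s <= 0 -> placeable N2 (outer s a2 b2)) ->
  (a1 < a)%N -> (a2 <= a)%N -> (b1 <= b)%N -> (b2 < b)%N ->
  (b1 + a2 <= (al.+1 + be.+1).+1)%N -> placeable (N1 + N2) (outer h a b).
Proof.
move=> h1 h0 E1 E2 *.
(* The midpoint of -1 and [h] leaves room above -1 for the slopes of all deeper levels. *)
have s1 : -1 < (h - 1) / 2 by lra.
have s0 : (h - 1) / 2 <= 0 by lra.
have sh : (h - 1) / 2 < h by lra.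
apply: placeable_imp (placeable_glue (ltW s1) sh (E1 _ s1 s0) (E2 _ s1 s0)).
by move=> P [P1 [P2 [-> u1 u2 x]]]; apply: (up_node u1 u2).
Qed.

(** All leaves of this X are copies of Y with clusters of [m] collinear points, which need bounds of
    at least 2. A node has [b1 + a2 = a + b + 4], to be compared with [al + be + 3]. *)
Lemma placeable_clusters a b h : (2 <= m)%N -> (a + b <= al + be + 3 - 4)%N ->
  -1 < h -> h <= 0 -> placeable (m * AY * 'C(a + b, a)) (outer h a.+2 b.+2).
Proof.
move=> m2 ab h1 h0; move: a b ab h h1 h0.
pose F N a b := (a + b <= al + be + 3 - 4)%N -> forall h : R, -1 < h -> h <= 0 ->
    placeable N (outer h a.+2 b.+2).
suff H a b : F (m * AY * 'C(a + b, a))%N a b by move=> *; apply: H.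
apply: (binomial_tree (F := F)) => [a' _ h h1 _|b' _ h h1 _|N1 N2 a' b' IH1 IH2 ab h h1 h0].
- by apply: placeable_block => //; move: m2; clear; lia.
- by apply: placeable_block => //; move: m2; clear; lia.
- apply: (placeable_outer h1 h0 (IH1 _) (IH2 _)) => //; move: ab; clear; lia.
Qed.

(** The number of nodes with parameters (1, 1) in a binomial tree. The value 0 on the boundary makes
    Pascal's rule hold for positive parameters other than (1, 1). *)
Definition pred_bin a b := (if (0 < a) && (0 < b) then 'C(a.-1 + b.-1, a.-1) else 0)%N.

(** A leaf with a bound equal to 1 is a copy of Y with single points. A node with parameters (1, 1)
    would have two such leaves; one copy of Y with clusters of [m] points takes their place, a gain
    of [(m - 2) * AY] points. *)
Lemma placeable_mixed a b h : (2 <= m)%N -> (a + b <= al + be + 1)%N ->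
  -1 < h -> h <= 0 ->
  placeable (('C(a + b, a) + (m - 2) * pred_bin a b) * AY) (outer h a.+1 b.+1).
Proof.
move=> m2; move e : (a + b)%N => n; rewrite -e.
elim: n a b e h => [|n IH] a b e h ab h1 h0.
  have [-> ->] : a = 0%N /\ b = 0%N by move: e; clear; lia.
  by rewrite /pred_bin /= muln0 addn0 binn; apply: placeable_block => //; apply: ltnW.
case: a e ab => [|a] e ab.
  by rewrite /pred_bin /= muln0 addn0 bin0; apply: placeable_block => //; apply: ltnW.
case: b e ab => [|b] e ab.
  by rewrite /pred_bin /= muln0 addn0 addn0 binn; apply: placeable_block => //; apply: ltnW.
have [/andP[/eqP a0 /eqP b0]|nz] := boolP ((a == 0%N) && (b == 0%N)).
  rewrite a0 b0 /pred_bin /= muln1.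
  have -> : ('C(1 + 1, 1) + (m - 2) = m)%N by move: m2; clear; rewrite bin1; lia.
  by apply: placeable_block => //; move: m2; clear; lia.
have -> : (('C(a.+1 + b.+1, a.+1) + (m - 2) * pred_bin a.+1 b.+1) * AY =
  ('C(a + b.+1, a) + (m - 2) * pred_bin a b.+1) * AY +
  ('C(a.+1 + b, a.+1) + (m - 2) * pred_bin a.+1 b) * AY)%N.
  rewrite -mulnDl; congr (_ * _)%N; rewrite addnACA -mulnDr; congr (_ + _ * _)%N.
    by rewrite addSn binS addnC addSnnS.
  rewrite /pred_bin /= andbT; case: a nz {e ab} => [|a]; case: b => [|b] //= _.
  - by rewrite !bin0.
  - by rewrite !addn0 !binn.
  - by rewrite addSn binS addnC addSnnS.
apply: (@placeable_outer _ _ h _ _ a.+1 b.+2 a.+2 b.+1) => // [s s1 s0|s s1 s0|].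
- by apply: IH => //; move: e ab; clear; lia.
- by apply: IH => //; move: e ab; clear; lia.
- by move: ab; clear; lia.
Qed.

End Outer.
End Build.

(** * Three clusters without five points in convex position *)

Section ThreeClusters.
Context {R : realFieldType} {T : eqType}.
Variables (sl : T -> T -> R) (th : T -> R) (sg : pred T).
Notation cvx := (pairwise (cv sl th sg)).
Notation within u v := (allrel (fun p q => (u < sl p q) && (sl p q < v))).

Lemma high_right p q : cv sl th sg p q -> sl p q < 1 -> 1 < th p -> ~~ sg q.
Proof. by rewrite /cv; case: (sg p); case: (sg q) => // /andP[? ?]; lra. Qed.

Lemma high_left p q : cv sl th sg p q -> sl p q < 1 -> 1 < th q -> sg p.
Proof. by rewrite /cv; case: (sg p); case: (sg q) => // /andP[? ?]; lra. Qed.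

Lemma high_or_WU p q : cv sl th sg p q -> sl p q = 1 ->
  (exists2 x, x \in [:: p; q] & 1 < th x) \/ (~~ sg p && sg q).
Proof.
rewrite /cv => + e; rewrite e; case: (sg p); case: (sg q) => /andP[h1 h2]; [left|left|by right|left].
- by exists q; rewrite ?inE ?eqxx ?orbT.
- by exists p; rewrite ?inE ?eqxx ?orbT.
- by exists p; rewrite ?inE ?eqxx ?orbT.
Qed.

Lemma low_or_UW p q : cv sl th sg p q -> sl p q = -1 ->
  (exists2 x, x \in [:: p; q] & th x <= -1) \/ (sg p && ~~ sg q).
Proof.
rewrite /cv => + e; rewrite e; case: (sg p); case: (sg q) => /andP[h1 h2]; [left|by right|left|left].
- by exists p; rewrite ?inE ?eqxx ?orbT ?ltW.
- by exists p; rewrite ?inE ?eqxx ?orbT ?ltW.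
- by exists q; rewrite ?inE ?eqxx ?orbT ?ltW.
Qed.

(** Either a pair inside a cluster has an extreme tangent, which fixes the signs in other clusters,
    or its own signs are forced: (W, U) for slope 1, (U, W) for slope -1. When both pairs have
    forced signs, the slopes among [p], [r], [t] are contradictory. *)
Lemma clusters_221 p q r s t : cvx [:: p; q; r; s; t] -> med sl [:: p; r; t] ->
  sl p q = 1 -> sl r s = -1 -> within (-1) 0 [:: p; q] [:: r; s] ->
  within 0 1 [:: p; q; r; s] [:: t] -> False.
Proof.
move=> + m pq rs /allrelP x2 /allrelP x3.
rewrite /= !andbT => /and4P[/and4P[cpq cpr cps cpt] /and3P[cqr cqs cqt] /andP[crs crt] cst].
have c12 x y : x \in [:: p; q] -> y \in [:: r; s] -> cv sl th sg x y.
  by rewrite !inE => /orP[]/eqP-> /orP[]/eqP->.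
have ct x : x \in [:: p; q; r; s] -> cv sl th sg x t.
  by rewrite !inE => /or4P[]/eqP->.
have [[x xi xh]|] := high_or_WU cpq pq.
  have W y : y \in [:: r; s] -> ~~ sg y.
    by move=> yi; apply: high_right (c12 _ _ xi yi) _ xh; have /andP[_] := x2 _ _ xi yi; lra.
  have xi' : x \in [:: p; q; r; s] by move: xi; rewrite !inE => /orP[]->; rewrite ?orbT.
  have Wt : ~~ sg t.
    by apply: high_right (ct _ xi') _ xh; have /andP[_] := x3 _ t xi' (mem_head _ _).
  have [[y yi yl]|] := low_or_UW crs rs; last first.
    by rewrite (negPf (W r (mem_head _ _))).
  have yi' : y \in [:: p; q; r; s] by move: yi; rewrite !inE => /orP[]->; rewrite ?orbT.
  case/negP: Wt; apply: low_right (ct _ yi') _ yl.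
  by have /andP[] := x3 _ t yi' (mem_head _ _); lra.
move=> /andP[gp gq]; have [[y yi yl]|/andP[gr gs]] := low_or_UW crs rs.
  have qi : q \in [:: p; q] by rewrite !inE eqxx orbT.
  have := low_left (c12 _ _ qi yi) _ yl; rewrite gq => /(_ _)/negP; apply=> //.
  by have /andP[] := x2 _ _ qi yi; lra.
have /andP[pr1 pr2] : -1 < sl p r < 0 by apply: x2; rewrite !inE eqxx ?orbT.
have /andP[rt1 rt2] : 0 < sl r t < 1 by apply: x3; rewrite !inE eqxx ?orbT.
have := m p r t (subseq_refl _); move: cpr crt cpt; rewrite /cv (negPf gp) gr.
by case: (sg t) => /andP[? ?] /andP[? ?] /andP[? ?] /orP[]/andP[? ?]; lra.
Qed.

Lemma clusters_212 p q r t u : cvx [:: p; q; r; t; u] ->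
  sl p q = 1 -> sl t u = 1 -> within (-1) 0 [:: p; q] [:: r] ->
  within 0 1 [:: p; q; r] [:: t; u] -> False.
Proof.
move=> + pq tu /allrelP x2 /allrelP x3.
rewrite /= !andbT => /and4P[/and4P[cpq cpr cpt cpu] /and3P[cqr cqt cqu] /andP[crt cru] ctu].
have c1 x : x \in [:: p; q] -> cv sl th sg x r by rewrite !inE => /orP[]/eqP->.
have c3 x y : x \in [:: p; q; r] -> y \in [:: t; u] -> cv sl th sg x y.
  by rewrite !inE => /or3P[]/eqP-> /orP[]/eqP->.
have high y : y \in [:: t; u] -> 1 < th y -> forall x, x \in [:: p; q; r] -> sg x.
  by move=> yi yh x xi; apply: high_left (c3 _ _ xi yi) _ yh; have /andP[] := x3 _ _ xi yi.
have [[x xi xh]|/andP[gp gq]] := high_or_WU cpq pq.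
  have xi' : x \in [:: p; q; r] by move: xi; rewrite !inE => /orP[]->; rewrite ?orbT.
  have Wr : ~~ sg r.
    by apply: high_right (c1 _ xi) _ xh; have /andP[_] := x2 _ r xi (mem_head _ _); lra.
  have W y : y \in [:: t; u] -> ~~ sg y.
    by move=> yi; apply: high_right (c3 _ _ xi' yi) _ xh; have /andP[] := x3 _ _ xi' yi.
  have [[y yi yh]|] := high_or_WU ctu tu.
    by case/negP: Wr; apply: high yi yh _ _; rewrite !inE eqxx !orbT.
  by rewrite (negPf (W u _)) ?andbF // !inE eqxx orbT.
have [[y yi yh]|/andP[gt gu]] := high_or_WU ctu tu.
  by case/negP: gp; apply: high yi yh _ _; rewrite !inE eqxx.
have /andP[pr1 pr2] : -1 < sl p r < 0 by apply: x2; rewrite !inE eqxx ?orbT.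
have /andP[rt1 rt2] : 0 < sl r t < 1 by apply: x3; rewrite !inE eqxx ?orbT.
move: cpr crt; rewrite /cv (negPf gp) (negPf gt).
by case: (sg r) => /andP[? ?] /andP[? ?]; lra.
Qed.

Lemma clusters_122 p r s t u : cvx [:: p; r; s; t; u] ->
  sl r s = -1 -> sl t u = 1 -> within (-1) 0 [:: p] [:: r; s] ->
  within 0 1 [:: p; r; s] [:: t; u] -> False.
Proof.
move=> + rs tu /allrelP x2 /allrelP x3.
rewrite /= !andbT => /and4P[/and4P[cpr cps cpt cpu] /and3P[crs crt cru] /andP[cst csu] ctu].
have c1 x : x \in [:: r; s] -> cv sl th sg p x by rewrite !inE => /orP[]/eqP->.
have c3 x y : x \in [:: p; r; s] -> y \in [:: t; u] -> cv sl th sg x y.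
  by rewrite !inE => /or3P[]/eqP-> /orP[]/eqP->.
have [[y yi yh]|/andP[gt gu]] := high_or_WU ctu tu.
  have U x : x \in [:: p; r; s] -> sg x.
    by move=> xi; apply: high_left (c3 _ _ xi yi) _ yh; have /andP[] := x3 _ _ xi yi.
  have [[x xi xl]|] := low_or_UW crs rs.
    have := low_left (c1 _ xi) _ xl; rewrite U ?inE ?eqxx // => /(_ _)/negP; apply=> //.
    by have /andP[] := x2 p _ (mem_head _ _) xi; lra.
  by rewrite (U s) ?andbF // !inE eqxx !orbT.
have [[x xi xl]|/andP[gr gs]] := low_or_UW crs rs.
  have xi' : x \in [:: p; r; s] by move: xi; rewrite !inE => /orP[]->; rewrite ?orbT.
  have ti : t \in [:: t; u] by rewrite mem_head.
  case/negP: gt; apply: low_right (c3 _ _ xi' ti) _ xl.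
  by have /andP[] := x3 _ _ xi' ti; lra.
have /andP[pr1 pr2] : -1 < sl p r < 0 by apply: x2; rewrite !inE eqxx ?orbT.
have /andP[rt1 rt2] : 0 < sl r t < 1 by apply: x3; rewrite !inE eqxx ?orbT.
have /andP[pt1 pt2] : 0 < sl p t < 1 by apply: x3; rewrite !inE eqxx ?orbT.
move: cpr crt cpt; rewrite /cv gr (negPf gt).
by case: (sg p) => /andP[? ?] /andP[? ?] /andP[? ?]; lra.
Qed.

Lemma subseq_skip (p q r s t : T) : subseq [:: p; r; t] [:: p; q; r; s; t].
Proof.
rewrite (@cat_subseq _ [:: p] [:: r; t] [:: p]) //.
apply: subseq_trans (subseq_cons _ q).
by rewrite (@cat_subseq _ [:: r] [:: t] [:: r]) // subseq_cons.
Qed.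

(** Each cluster contributes at most two points, so five points would include two, two and one in
    some order. *)
Lemma three_clusters_bound Q1 Q2 Q3 : cvx ((Q1 ++ Q2) ++ Q3) -> med sl ((Q1 ++ Q2) ++ Q3) ->
  pairwise (fun p q => sl p q == 1) Q1 -> pairwise (fun p q => sl p q == -1) Q2 ->
  pairwise (fun p q => sl p q == 1) Q3 -> within (-1) 0 Q1 Q2 -> within 0 1 (Q1 ++ Q2) Q3 ->
  (size ((Q1 ++ Q2) ++ Q3) <= 4)%N.
Proof.
move=> c m e1 e2 e3 x2 x3; have := c; rewrite !pairwise_cat => /and3P[_ /and3P[_ c1 c2] c3].
have := (collinear_le2 c1 e1, collinear_le2 c2 e2, collinear_le2 c3 e3).
clear c1 c2 c3.
move: Q1 Q2 Q3 c m e1 e2 e3 x2 x3 => [|p [|q [|? ?]]] [|r [|s [|? ?]]] [|t [|u [|? ?]]] //;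
  try (by move=> _ _ _ _ _ _ _ [[]]); rewrite ?pairwise2.
- move=> c _ _ /eqP e2 /eqP e3 x2 x3; have [] := clusters_122 c e2 e3 x2 x3.
- move=> c _ /eqP e1 _ /eqP e3 x2 x3; have [] := clusters_212 c e1 e3 x2 x3.
- move=> c m /eqP e1 /eqP e2 _ x2 x3; have [] := clusters_221 c _ e1 e2 x2 x3.
  by apply: med_subseq m; apply: subseq_skip.
move=> c m /eqP e1 /eqP e2 _ x2 x3.
have [] := @clusters_221 p q r s t _ _ e1 e2 x2 _.
- by apply: subseq_pairwise c; apply: (prefix_subseq [:: p; q; r; s; t] [:: u]).
- apply: med_subseq m; apply: (@subseq_trans _ [:: p; q; r; s; t]).
    exact: subseq_skip.
  exact: (prefix_subseq [:: p; q; r; s; t] [:: u]).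
- apply: allrel_subseq x3; first exact: subseq_refl.
  exact: (prefix_subseq [:: t] [:: u]).
Qed.
End ThreeClusters.

(** * From cells to slopes *)

Section DualLines.
Import numFieldNormedType.Exports.
Local Open Scope classical_set_scope.
Context {R : realType}.
Implicit Types (p z : (R * R)%type).

Definition height p z : R := p.1 * z.1 - p.2 - z.2.

Definition dual_line p : set (R * R) := [set z | height p z = 0].

Lemma height_continuous p : continuous (height p).
Proof.
move=> z; rewrite /height; apply: cvgB; last exact: cvg_snd.
apply: cvgB; last exact: cvg_cst.
by apply: cvgM; [exact: cvg_cst|exact: cvg_fst].
Qed.

(** The image of a connected set is an interval, which contains 0 if it contains values of both
    signs. *)
Lemma connected_height_sign p (P : set (R * R)) x : connected P -> P x ->
  (forall z, P z -> height p z <> 0) ->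
  forall z, P z -> 0 < height p x * height p z.
Proof.
move=> cP Px nz z Pz.
have ivl : is_interval (height p @` P).
  apply/connected_intervalP; apply: connected_continuous_connected cP _.
  by apply: continuous_subspaceT => y; apply: height_continuous.
have n0 : height p x != 0 by apply/eqP/nz.
have n1 : height p z != 0 by apply/eqP/nz.
rewrite lt_neqAle eq_sym mulf_neq0 //= leNgt; apply/negP => neg.
suff [w Pw w0] : (height p @` P) 0 by exact: nz w0.
have Ix : (height p @` P) (height p x) by exists x.
have Iz : (height p @` P) (height p z) by exists z.
case: (ltgtP (height p x) 0) n0 => // hx _.
  have hz : 0 < height p z by rewrite -(nmulr_rlt0 _ hx).
  by apply: (ivl _ _ Ix Iz); rewrite (ltW hx) (ltW hz).
have hz : height p z < 0 by rewrite -(pmulr_rlt0 _ hx).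
by apply: (ivl _ _ Iz Ix); rewrite (ltW hx) (ltW hz).
Qed.

Lemma closure_height_sign p (P : set (R * R)) c :
  (forall z, P z -> 0 < c * height p z) -> forall z, closure P z -> 0 <= c * height p z.
Proof.
move=> h; have cl : closed ((fun z => c * height p z) @^-1` [set r | 0 <= r]).
  apply: preimage_closed; last exact: closed_ge.
  by move=> z _; apply: cvgM; [exact: cvg_cst|exact: height_continuous].
move=> z; rewrite closure_id in cl; have PS : P `<=` (fun z => c * height p z) @^-1` [set r | 0 <= r].
  by move=> w /h /ltW.
by move/(closureS PS); rewrite -cl.
Qed.

Section Cells.
Context {I : finType}.
Variables (pt : I -> (R * R)%type) (L : I -> set (R * R)).
Hypothesis LE : forall i, L i = dual_line (pt i).
Hypothesis slopes : forall i j, i != j -> (pt i).1 != (pt j).1.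

(* The abscissa of a point of the cell's edge on [L i] is the slope of a line
   through the dual point [pt i] separating the other dual points. *)
Lemma convex_position_dual : convex_position L ->
  exists (sg : I -> bool) (th : I -> R), forall i j, i != j ->
    let d := th i * ((pt j).1 - (pt i).1) - ((pt j).2 - (pt i).2) in
    if sg j then d < 0 else 0 < d.
Proof.
case=> P [x Ax PE] cS.
have bd i : bounded_by P (L i).
  by have := subset_cardP cS (subset_predT _) i; rewrite inE => /asboolP.
have Px : P x by rewrite PE; apply: connected_component_refl.
have cP : connected P by rewrite PE; apply: component_connected.
have Pn j z : P z -> height (pt j) z <> 0.
  rewrite PE => /connected_component_sub zA hz; apply: zA.
  by exists j => //; rewrite LE.
have sgn j z : closure P z -> 0 <= height (pt j) x * height (pt j) z.
  by apply: closure_height_sign => w Pw; apply: connected_height_sign cP Px _ w Pw; apply: Pn.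
have edge i : exists t : R, forall j, i != j ->
    0 < height (pt j) x * (t * ((pt j).1 - (pt i).1) - ((pt j).2 - (pt i).2)).
  have [p [q [pq seg]]] := bd i.
  have on z : segment p q z -> height (pt i) z = 0 /\ closure P z.
    by move/seg => -[]; rewrite LE => ? [].
  have [hp cp] : height (pt i) p = 0 /\ closure P p.
    apply: on; exists 0; first by rewrite /= in_itv /= lexx ler01.
    by case: (p) => p1 p2 /=; rewrite subr0 !mul1r !mul0r !addr0.
  have [hq cq] : height (pt i) q = 0 /\ closure P q.
    apply: on; exists 1; first by rewrite /= in_itv /= lexx ler01.
    by case: (q) => q1 q2 /=; rewrite subrr !mul1r !mul0r !add0r.
  (* At the midpoint of the edge the height over another line is the mean of those at [p] and [q];
     it vanishes only if both points lie on both lines, which have different slopes. *)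
  exists ((p.1 + q.1) / 2) => j ij.
  have c0 : height (pt j) x != 0 by apply/eqP/Pn.
  have ne := slopes ij.
  move: (height (pt j) x) c0 (sgn j _ cp) (sgn j _ cq) hp hq => c c0.
  rewrite /height => sp sq hp hq.
  have hp2 : p.2 = (pt i).1 * p.1 - (pt i).2 by lra.
  have hq2 : q.2 = (pt i).1 * q.1 - (pt i).2 by lra.
  have -> : c * ((p.1 + q.1) / 2 * ((pt j).1 - (pt i).1) - ((pt j).2 - (pt i).2)) =
    (c * ((pt j).1 * p.1 - (pt j).2 - p.2) + c * ((pt j).1 * q.1 - (pt j).2 - q.2)) / 2.
    by rewrite hp2 hq2; field.
  rewrite divr_gt0 // lt_neqAle addr_ge0 // andbT eq_sym paddr_eq0 //.
  rewrite !mulf_eq0 (negPf c0) /=; apply/negP => /andP[/eqP ep /eqP eq].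
  have e1 : p.1 = q.1.
    have : ((pt i).1 - (pt j).1) * (p.1 - q.1) = 0 by lra.
    by move/eqP; rewrite mulf_eq0 !subr_eq0 (negPf ne) => /eqP.
  move/eqP: pq; apply; apply/eqP; rewrite [p]surjective_pairing [q]surjective_pairing.
  by rewrite hp2 hq2 e1.
have [th thP] := choice edge.
(* A negative height means that the cell lies above line [j]; dually, point [j] is in U. *)
exists (fun j => height (pt j) x < 0), th => i j ij /=.
have := thP i j ij; case: ifPn => [hx|]; first by rewrite nmulr_rgt0.
rewrite -leNgt le_eqVlt => /orP[/eqP<-|hx]; first by rewrite mul0r ltxx.
by rewrite pmulr_rgt0.
Qed.

End Cells.

End DualLines.

(** * The lower bound *)

Section Transfer.
Context {R : realType}.
Notation pt := (R * R)%type.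
Notation sl := (@slope R).
Local Open Scope classical_set_scope.

Definition avoids m n (P : seq pt) : Prop :=
  [/\ ordered P,
      forall Q c, subseq Q P -> pairwise (fun p q => sl p q == c) Q -> (size Q <= m)%N &
      forall Q th (sg : pred pt), subseq Q P -> pairwise (cv sl th sg) Q -> (size Q < n)%N].

(** Slope conditions read points from left to right, whereas a subfamily is an arbitrary injection;
    listing its indices in increasing order gives a subsequence. *)
Lemma subseq_of_injection M n (P : seq pt) (f : 'I_n -> 'I_M) : (M <= size P)%N ->
  injective f -> exists Q : seq pt, [/\ subseq Q P, size Q = n &
    forall p, p \in Q -> exists k, nth 0 P (f k) = p].
Proof.
move=> MP fi; pose s := [seq val (f k) | k <- enum 'I_n].
exists [seq nth 0 P i | i <- iota 0 (size P) & i \in s]; split.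
- rewrite -[X in subseq _ X](mkseq_nth 0); apply: map_subseq; exact: filter_subseq.
- have -> : n = size s by rewrite size_map size_enum_ord.
  rewrite size_map; apply/perm_size/uniq_perm; rewrite ?filter_uniq ?iota_uniq //.
    by rewrite map_inj_uniq ?enum_uniq // => i j /val_inj/fi.
  move=> i; rewrite mem_filter mem_iota /= add0n.
  case: (boolP (i \in s)) => //= /mapP[k _ ->].
  by rewrite (leq_trans (ltn_ord _) MP).
- move=> p /mapP[i]; rewrite mem_filter => /andP[/mapP[k _ ->] _] ->.
  by exists k.
Qed.

Lemma avoids_not_ES l n M (P : seq pt) : (2 < l)%N -> avoids l.-1 n P -> (M <= size P)%N ->
  ~ ES_property R l n M.
Proof.
move=> l3 [oP cs cx] MP ES; pose L (i : 'I_M) := dual_line (nth 0 P i).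
have nthlt (i j : 'I_M) : (i < j)%N -> (nth 0 P i).1 < (nth 0 P j).1.
  move=> ij; apply: (pairwiseP 0 oP) => //; rewrite inE; apply: leq_trans MP; exact: ltn_ord.
have nthne (i j : 'I_M) : i != j -> (nth 0 P i).1 != (nth 0 P j).1.
  move=> ij; case: (ltngtP i j) => h; first by rewrite lt_eqF ?nthlt.
    by rewrite gt_eqF ?nthlt.
  by case/eqP: ij; apply: val_inj.
have lines i : is_line (L i).
  exists (nth 0 P i).1, (-1), (nth 0 P i).2; split; first by rewrite oppr_eq0 oner_eq0 orbT.
  by apply/seteqP; split=> z /=; rewrite /L /dual_line /height /= => h; lra.
have ngp : nearly_general_position L.
  split=> [i j ij|i [c e]].
    have ne := nthne i j ij; set p := nth 0 P i in ne; set q := nth 0 P j in ne.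
    case=> [e|e].
      have : L i (0, - p.2) by rewrite /L /dual_line /height /=; ring.
      have : L i (1, p.1 - p.2) by rewrite /L /dual_line /height /=; ring.
      rewrite e /L /dual_line /height /= -/q => h1 h0.
      by case/eqP: ne; lra.
    pose x := (p.2 - q.2) / (p.1 - q.1).
    have x1 : x * (p.1 - q.1) = p.2 - q.2 by rewrite /x divfK // subr_eq0.
    suff : (L i `&` L j) (x, p.1 * x - p.2) by rewrite e.
    by split; rewrite /L /dual_line /height /= -/p -/q; lra.
  pose p := nth 0 P i.
  have h0 : L i (0, - p.2) by rewrite /L /dual_line /height /=; ring.
  have h1 : L i (1, p.1 - p.2) by rewrite /L /dual_line /height /=; ring.
  by move: h0 h1; rewrite e /= => <- /eqP; rewrite oner_eq0.
case: (ES L lines ngp) => [[f fi [z zL]]|[f fi conv]].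
  have [Q [sub sQ Qf]] := subseq_of_injection MP fi.
  have : (size Q <= l.-1)%N; last by rewrite sQ; case: (l) l3 => // l' _; rewrite ltnn.
  (* Lines through [z] are dual to points on a line of slope [z.1]. *)
  apply: (cs Q z.1 sub); apply/pwP => p q sub2.
  have pq : p.1 < q.1 by apply: (pwP _ _).2 oP _ _ (subseq_trans sub2 sub).
  have [pQ qQ] := subseq2_mem sub2; have [[k kp] [k' kq]] := (Qf _ pQ, Qf _ qQ).
  have := zL k; have := zL k'; rewrite /L /= /dual_line /height /= kp kq => h1 h2.
  have x0 : q.1 - p.1 != 0 by rewrite subr_eq0 gt_eqF.
  by apply/eqP; apply: (mulIf x0); rewrite slopeE //; lra.
have [Q [sub sQ Qf]] := subseq_of_injection MP fi.
have inj' i j : i != j -> (nth 0 P (f i)).1 != (nth 0 P (f j)).1.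
  by move=> ij; apply: nthne; apply: contra_neq ij => /fi.
have [sg [th h]] := convex_position_dual (pt := fun k => nth 0 P (f k)) (fun i => erefl) inj' conv.
(* Signs and tangents are transported from indices to points, with arbitrary values elsewhere. *)
pose idx p := [pick k | nth 0 P (f k) == p].
pose sg' p := if idx p is Some k then sg k else true.
pose th' p := if idx p is Some k then th k else 0.
have : (size Q < n)%N; last by rewrite sQ ltnn.
apply: (cx Q th' sg' sub); apply/pwP => p q sub2.
have pq : p.1 < q.1 by apply: (pwP _ _).2 oP _ _ (subseq_trans sub2 sub).
have [pQ qQ] := subseq2_mem sub2.
have [k kp [sk tk]] : exists2 k, nth 0 P (f k) = p & sg' p = sg k /\ th' p = th k.
  have [k0 e0] := Qf _ pQ; rewrite /sg' /th' /idx; case: pickP => [k /eqP e|/(_ k0)].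
    by exists k.
  by rewrite e0 eqxx.
have [j jq [sj tj]] : exists2 k, nth 0 P (f k) = q & sg' q = sg k /\ th' q = th k.
  have [k0 e0] := Qf _ qQ; rewrite /sg' /th' /idx; case: pickP => [k1 /eqP e|/(_ k0)].
    by exists k1.
  by rewrite e0 eqxx.
have kj : k != j.
  by apply/eqP => e; move: pq; rewrite -kp -jq e ltxx.
have jk : j != k by rewrite eq_sym.
have := h _ _ kj; have := h _ _ jk; rewrite kp jq /cv sk sj tk tj /=.
rewrite -(slopeE pq); have := pq; rewrite -subr_gt0 => d0.
rewrite -[p.1 - q.1]opprB -[p.2 - q.2]opprB -(slopeE pq) mulrN opprK addrC -!mulrBl.
rewrite !(pmulr_llt0 _ d0) !(pmulr_lgt0 _ d0) !subr_lt0 !subr_gt0.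
by case: (sg k); case: (sg j) => -> ->.
Qed.

Lemma ES_gt l n N ES : (2 < l)%N ->
  (exists P : seq pt, size P = N /\ avoids l.-1 n P) -> is_ES R l n ES -> (N < ES)%N.
Proof.
move=> l3 [P [<- av]] [h _]; rewrite ltnNge; apply/negP => le.
exact: avoids_not_ES l3 av le h.
Qed.

Lemma placeable_ex N (C : seq pt -> Prop) : placeable N C ->
  exists P, size P = N /\ [/\ C P, ordered P & low_slopes P].
Proof. by move=> h; have [P [? ? [? ?] _]] := h 0 0 1 ltr01; exists P. Qed.

(** Convex sets have at most [al + be + 1] points. A collinear set is bounded first in X, then
    inside a copy of Y. *)
Lemma outer_avoids m al be h a b P : h <= 0 -> up sl 0 (al + be).+1 (block sl m al be) h a b P ->
  ordered P -> low_slopes P -> (2 <= m)%N -> (a <= be + 2)%N -> (b <= al + 2)%N ->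
  (0 < al)%N -> (0 < be)%N -> (4 <= al + be)%N -> avoids m (al + be).+2 P.
Proof.
move=> h0 u o lo m2 ab ba al0 be0 B5; split=> // [Q c sub e|Q th sg sub cQ].
  apply: (const_slope_bound _ m2 (outer_subseq u sub) e) => a' b' S [d [_ _ dm i]] eS.
  rewrite -size_rev; apply: (const_slope_bound (c := - c) _ m2 i).
    by move=> ? ? ? [_ _ s _] _; apply: leq_trans s dm.
  by rewrite pairwise_rev; apply: sub_pairwise eS => p q /eqP <-.
rewrite ltnS; apply: (outer_bound h0 (outer_subseq u sub) cQ) => //.
  exact: subseq_pairwise sub lo.
exact: med_subseq sub (ordered_med o).
Qed.

(* The case n = 5, for which the constraint of the root in [odd_avoid] fails. *)
Lemma clusters_avoid m : (2 <= m)%N ->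
  exists P : seq pt, size P = (m + m + m)%N /\ avoids m 5 P.
Proof.
move=> m2.
have i1 : (-1 <= 1 :> R) && (1 <= 1 :> R) by rewrite lexx andbT; lra.
have i2 : (-1 <= -1 :> R) && (-1 <= 1 :> R) by rewrite lexx /=; lra.
have u0 : (-1 : R) <= 0 by lra.
have u1 : (-1 : R) < 0 by lra.
have g1 := placeable_glue (lexx _) u1 (placeable_leaf m i1) (placeable_leaf m i2).
have [P [sP [[P' [P3 [-> [P1 [P2 [-> [s1 e1] [s2 e2] x12]]] [s3 e3] x3]]] o _]]] :=
  placeable_ex (placeable_glue u0 ltr01 g1 (placeable_leaf m i1)).
exists ((P1 ++ P2) ++ P3); split; first by rewrite !size_cat s1 s2 s3.
have dec Q : subseq Q ((P1 ++ P2) ++ P3) -> exists Q1 Q2 Q3, [/\ Q = (Q1 ++ Q2) ++ Q3,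
    subseq Q1 P1, subseq Q2 P2, subseq Q3 P3 & subseq (Q1 ++ Q2) (P1 ++ P2)].
  move=> /subseq_catP[Q' [Q3 [-> s12 sub3]]]; have [Q1 [Q2 [e sub1 sub2]]] := subseq_catP s12.
  by exists Q1, Q2, Q3; split; rewrite // ?e // -?e.
split=> // [Q c sub|Q th sg sub cQ].
  have [Q1 [Q2 [Q3 [-> t1 t2 t3 t12]]]] := dec _ sub.
  have [/allrelP y12 /allrelP y3] := (allrel_subseq t1 t2 x12, allrel_subseq t12 t3 x3).
  rewrite !pairwise_cat => /and3P[/allrelP c3 /and3P[/allrelP c12 d1 d2] d3].
  have small d S : pairwise (fun p q => sl p q == d) S ->
      pairwise (fun p q => sl p q == c) S -> c != d -> (size S <= 1)%N.
    move=> /pwP eS /pwP cS /eqP cd; apply: size_le1 => p q h; apply: cd.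
    by rewrite -(eqP (eS _ _ h)) (eqP (cS _ _ h)).
  have [l1 [l2 l3]] : (size Q1 <= m)%N /\ (size Q2 <= m)%N /\ (size Q3 <= m)%N.
    by rewrite -{1}s1 -{1}s2 -s3 !size_subseq.
  have f1 := small _ _ (subseq_pairwise t1 e1) d1.
  have f2 := small _ _ (subseq_pairwise t2 e2) d2.
  have f3 := small _ _ (subseq_pairwise t3 e3) d3.
  (* A line meeting two clusters has at most one point in each. It cannot meet all three, since its
     slope would be both negative and positive. *)
  have [z3|/nonempty_mem[r rQ]] := eqVneq Q3 [::].
    rewrite z3 cats0; have [->|/nonempty_mem[p pQ]] := eqVneq Q1 [::]; first by [].
    have [->|/nonempty_mem[q qQ]] := eqVneq Q2 [::]; first by rewrite cats0.
    have := y12 _ _ pQ qQ; rewrite (eqP (c12 _ _ pQ qQ)) => /andP[c1 c0].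
    rewrite size_cat; apply: (@leq_trans (1 + 1)) m2; apply: leq_add; [apply: f1|apply: f2].
      by rewrite lt_eqF //; lra.
    by rewrite gt_eqF.
  have [z12|/nonempty_mem[p pQ]] := eqVneq (Q1 ++ Q2) [::]; first by rewrite z12.
  have := y3 _ _ pQ rQ; rewrite (eqP (c3 _ _ pQ rQ)) => /andP[c0 c1].
  rewrite size_cat; apply: (@leq_trans (1 + 1)) m2; apply: leq_add; last by apply: f3; rewrite lt_eqF.
  have [->|/nonempty_mem[x xQ]] := eqVneq Q1 [::].
    by apply: f2; rewrite gt_eqF //; lra.
  have [->|/nonempty_mem[y yQ]] := eqVneq Q2 [::].
    by rewrite cats0; apply: f1; rewrite lt_eqF.
  by have := y12 _ _ xQ yQ; rewrite (eqP (c12 _ _ xQ yQ)) => /andP[_]; lra.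
have [Q1 [Q2 [Q3 [eQ t1 t2 t3 t12]]]] := dec _ sub.
rewrite eQ in sub cQ *.
apply: (@three_clusters_bound _ _ sl th sg) => //.
- exact: med_subseq sub (ordered_med o).
- exact: subseq_pairwise t1 e1.
- exact: subseq_pairwise t2 e2.
- exact: subseq_pairwise t3 e3.
- exact: allrel_subseq t1 t2 x12.
- exact: allrel_subseq t12 t3 x3.
Qed.

(* The case n = 2k + 2 with k = j + 2. *)
Lemma even_avoid m j : (2 <= m)%N -> exists P : seq pt,
  size P = (m * 'C(2 * j + 2, j.+1) * 'C(2 * j + 1, j) +
    ('C(2 * j + 2, j.+1) + (m - 2) * 'C(2 * j, j)) * 'C(2 * j + 2, j.+1))%N /\
  avoids m (2 * j + 6) P.
Proof.
move=> m2; pose al := j.+1.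
(* With these bounds the root has [b1 + a2 = 2 * j + 5], which is exactly the value of [B]. *)
have e1 (s : R) : -1 < s -> s <= 0 -> placeable (m * 'C(al + al, al) * 'C(j + j.+1, j))
    (up (@slope R) 0 (al.+1 + al.+1).+1 (block (@slope R) m al.+1 al.+1) s j.+2 j.+3).
  by move=> s1 s0; apply: placeable_clusters => //; rewrite /al; clear; lia.
have e2 (s : R) : -1 < s -> s <= 0 ->
    placeable (('C(al + al, al) + (m - 2) * pred_bin al al) * 'C(al + al, al))
    (up (@slope R) 0 (al.+1 + al.+1).+1 (block (@slope R) m al.+1 al.+1) s al.+1 al.+1).
  by move=> s1 s0; apply: placeable_mixed => //; rewrite /al; clear; lia.
have e3 := @placeable_outer R m al al _ _ 0 j.+3 j.+3 _ _ _ _ (ltrN10 R) (lexx 0) e1 e2.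
have [|||||P [sP [u oP lP]]] := placeable_ex (e3 _ _ _ _ _); try by rewrite /al; clear; lia.
exists P; split.
  have ea : (j.+1 + j.+1 = 2 * j + 2)%N by clear; lia.
  have eb : (j + j.+1 = 2 * j + 1)%N by clear; lia.
  have ec : (j + j = 2 * j)%N by clear; lia.
  by rewrite sP /pred_bin /al /= ea eb ec.
have -> : (2 * j + 6 = (al.+1 + al.+1).+2)%N by rewrite /al; clear; lia.
by apply: (outer_avoids (lexx 0) u oP lP m2); rewrite /al; clear; lia.
Qed.

(* The case n = 2k + 1 with k = j + 3. *)
Lemma odd_avoid m j : (2 <= m)%N -> exists P : seq pt,
  size P = (('C(2 * j + 4, j.+2) + (m - 2) * 'C(2 * j + 2, j.+1)) * 'C(2 * j + 3, j.+1) +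
   ('C(2 * j + 4, j.+2) + (m - 2) * 'C(2 * j + 2, j.+1)) * 'C(2 * j + 3, j.+1) +
   m * 'C(2 * j + 3, j.+1))%N /\
  avoids m (2 * j + 7) P.
Proof.
move=> m2; pose al := j.+1; pose be := j.+2.
pose F N (s : R) a b := placeable N
  (up (@slope R) 0 (al.+1 + be.+1).+1 (block (@slope R) m al.+1 be.+1) s a b).
pose N1 := (('C(be + be, be) + (m - 2) * pred_bin be be) * 'C(al + be, al))%N.
have e1 (s : R) : -1 < s -> s <= 0 -> F N1 s be.+1 be.+1.
  by move=> s1 s0; apply: placeable_mixed => //; rewrite /al /be; clear; lia.
have e2 (s : R) : -1 < s -> s <= 0 -> F (m * 'C(al + be, al))%N s 2%N 2%N.
  by move=> s1 _; apply: placeable_block => //; apply: geq_minr.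
have e3 (s : R) : -1 < s -> s <= 0 -> F (N1 + N1)%N s be.+2 be.+2.
  by move=> s1 s0; apply: (placeable_outer s1 s0 e1 e1); rewrite /al /be; clear; lia.
have e4 := @placeable_outer R m al be _ _ 0 be.+3 be.+2 _ _ _ _ (ltrN10 R) (lexx 0) e3 e2.
have [|||||P [sP [u oP lP]]] := placeable_ex (e4 _ _ _ _ _); try by rewrite /al /be; clear; lia.
exists P; split.
  have ea : (j.+2 + j.+2 = 2 * j + 4)%N by clear; lia.
  have eb : (j.+1 + j.+2 = 2 * j + 3)%N by clear; lia.
  have ec : (j.+1 + j.+1 = 2 * j + 2)%N by clear; lia.
  by rewrite sP /N1 /pred_bin /al /be /= ea eb ec.
have -> : (2 * j + 7 = (al.+1 + be.+1).+2)%N by rewrite /al /be; clear; lia.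
by apply: (outer_avoids (lexx 0) u oP lP m2); rewrite /al /be; clear; lia.
Qed.

End Transfer.

(** * Central binomial coefficients and comparison with the stated bounds *)

Lemma middle_bin j : 'C(2 * j + 1, j.+1) = 'C(2 * j + 1, j).
Proof.
have h : (j <= 2 * j + 1)%N by lia.
by rewrite -(bin_sub h); congr 'C(_, _); lia.
Qed.

Lemma central_binS j : ('C(2 * j + 2, j.+1) = 2 * 'C(2 * j + 1, j))%N.
Proof. by have := middle_bin j; rewrite addn2 addn1 => e; rewrite binS e addnn -mul2n. Qed.

Lemma central_bin_le j : ('C(2 * j + 2, j.+1) <= 4 * 'C(2 * j, j))%N.
Proof.
rewrite central_binS -[4%N]/(2 * 2)%N -mulnA leq_pmul2l // -middle_bin addn1.
rewrite -(leq_pmul2l (ltn0Sn j)) -mul_bin_diag /= mulnA leq_mul2r; lia.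
Qed.

Theorem theorem1p2 (R : realType) (l k n ES : nat)
    (hl : (3 <= l)%N) (hk : (2 <= k)%N) (hES : is_ES R l n ES) :
  (n = (2 * k + 2)%N ->
     (l%:Z - 1) * 'C(2 * k - 2, k - 1)%:Z ^+ 2
     - (l%:Z - 3) * 'C(2 * k - 4, k - 2)%:Z * 'C(2 * k - 2, k - 1)%:Z
     < ES%:Z) /\
  (n = (2 * k + 1)%N ->
     (l%:Z - 1) * ('C(2 * k - 2, k - 1)%:Z + 1) * 'C(2 * k - 3, k - 1)%:Z
     - (l%:Z - 3) * 'C(2 * k - 4, k - 2)%:Z * 'C(2 * k - 2, k - 1)%:Z
     < ES%:Z).
Proof.
have m2 : (2 <= l.-1)%N by move: hl; clear; lia.
have lm : l = l.-1.+1 by move: hl; clear; lia.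
split=> en; rewrite {}en in hES.
  case: k hk hES => [|[|j]] // _ hES; have [P [sP av]] := @even_avoid R l.-1 j m2.
  have en : (2 * j.+2 + 2 = 2 * j + 6)%N by clear; lia.
  rewrite en in hES; have := ES_gt hl (ex_intro _ P (conj sP av)) hES.
  have -> : (2 * j.+2 - 2 = 2 * j + 2)%N by clear; lia.
  have -> : (j.+2 - 1 = j.+1)%N by clear; lia.
  have -> : (2 * j.+2 - 4 = 2 * j)%N by clear; lia.
  have -> : (j.+2 - 2 = j)%N by clear; lia.
  have := central_bin_le j; rewrite central_binS.
  (* With [l - 1 = d + 2], the point set exceeds the stated bound by [2 * d * a * (2 * b - a)],
     which is nonnegative by [central_bin_le]. *)
  rewrite lm /=; move: m2; move: 'C(_, _) 'C(2 * j, j) (l.-1) => a b [|[|d]] //.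
  clear => _ ab; have : (d * a * a <= d * a * (2 * b))%N by rewrite leq_mul //; lia.
  rewrite subn2 /=; nia.
case: k hk hES => [|[|[|j]]] // _ hES.
  have [P [sP av]] := @clusters_avoid R l.-1 m2.
  have := ES_gt hl (ex_intro _ P (conj sP av)) hES.
  have [-> -> ->] : [/\ 'C(2 * 2 - 2, 2 - 1) = 2%N, 'C(2 * 2 - 4, 2 - 2) = 1%N &
    'C(2 * 2 - 3, 2 - 1) = 1%N] by [].
  by move: hl; clear; lia.
have [P [sP av]] := @odd_avoid R l.-1 j m2.
have en : (2 * j.+3 + 1 = 2 * j + 7)%N by clear; lia.
rewrite en in hES; have := ES_gt hl (ex_intro _ P (conj sP av)) hES.
have -> : (2 * j.+3 - 2 = 2 * j + 4)%N by clear; lia.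
have -> : (2 * j.+3 - 3 = 2 * j + 3)%N by clear; lia.
have -> : (j.+3 - 1 = j.+2)%N by clear; lia.
have -> : (2 * j.+3 - 4 = 2 * j + 2)%N by clear; lia.
have -> : (j.+3 - 2 = j.+1)%N by clear; lia.
have e3 : 'C(2 * j + 3, j.+2) = 'C(2 * j + 3, j.+1).
  by have := middle_bin j.+1; have -> : (2 * j.+1 + 1 = 2 * j + 3)%N by clear; lia.
have := central_binS j.+1; have := central_bin_le j.+1.
have -> : (2 * j.+1 + 2 = 2 * j + 4)%N by clear; lia.
have -> : (2 * j.+1 + 1 = 2 * j + 3)%N by clear; lia.
have -> : (2 * j.+1 = 2 * j + 2)%N by clear; lia.
rewrite e3 => le eq2; rewrite eq2 lm /= in le *; move: m2 le.
(* The excess is again [2 * d * a * (2 * b - a)]. *)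
move: 'C(2 * j + 3, j.+1) 'C(2 * j + 2, j.+1) (l.-1) => a b [|[|d]] //.
clear => _ ab; have : (d * a * a <= d * a * (2 * b))%N by rewrite leq_mul //; lia.
rewrite subn2 /=; nia.
Qed.
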